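(* Let $\mathbf{P} \in \mathrm{ri}(\mathcal{P}_d)$ and suppose that the piecewise McCormick outer-approximation problem at $\mathbf{P}$ has a unique $\mathbf{Y}$-solution $\mathbf{Y}^* \in \mathcal{Y}$ (i.e., $\mathbf{Y}^*$ is the unique minimizer of $v(\mathbf{P},\cdot)$ over $\mathcal{Y}$). Suppose the linear program defining $v(\mathbf{P},\mathbf{Y}^* )$, $$\min_{\mathbf{z} \ge \mathbf{0}} \ \mathbf{c}^{T}\mathbf{z} \quad \text{s.t.} \quad \mathbf{M}(\mathbf{P})\mathbf{z} = \mathbf{d}(\mathbf{P}), \quad \bar{\mathbf{M}}\mathbf{z} = \bar{\mathbf{B}}\,\mathrm{vec}(\mathbf{Y}^* ),$$ has a unique primal solution $\mathbf{z}^*$ and a unique dual solution $\boldsymbol{\pi}^*$, where $\pi^*_k$, $k \in [n_r]$, denote the components of the dual solution associated with the rows of $\mathbf{M}(\mathbf{P})\mathbf{z} = \mathbf{d}(\mathbf{P})$. Then for all $i \in \mathcal{NC}$ and $j \in \{2,\dots,d+1\}$, $$\frac{\partial \underline{v}}{\partial P_{ij}}(\mathbf{P}) = \frac{\partial v}{\partial P_{ij}}(\mathbf{P},\mathbf{Y}^* ) = \sum_{k=1}^{n_r} \pi^*_k \left[ \left( \sum_{l=1}^{n_c} z^*_l \frac{\partial M_{kl}}{\partial P_{ij}}(\mathbf{P}) \right) - \frac{\partial d_k}{\partial P_{ij}}(\mathbf{P}) \right].$$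
   Context: Notation: $[n]=\{1,\dots,n\}$; $\mathcal{S}^n$ is the set of symmetric $n\times n$ real matrices; $\langle\cdot,\cdot\rangle$ is the Frobenius inner product; $\mathrm{ri}$ denotes relative interior; $\mathrm{vec}$ is vectorization of a matrix. QCQP. Fix data $\mathbf{b}\in\mathbb{R}^m$, $\mathbf{r}^i\in\mathbb{R}^n$, $\mathbf{Q}^i\in\mathcal{S}^n$ (not assumed positive semidefinite), $i\in\{0\}\cup[m]$. Let $\mathcal{B}\subset\{(i,j)\in[n]^2: i<j\}$ and $\mathcal{Q}\subset[n]$ index the distinct bilinear terms $x_ix_j$ and univariate quadratic terms $x_k^2$ appearing in the problem (so all entries of the matrices $\mathbf{Q}^i$ not indexed by $\mathcal{B}$, up to symmetry, or by $\mathcal{Q}$ on the diagonal, are zero; only the entries of $\mathbf{W}$ indexed by $\mathcal{B}$ and $\mathcal{Q}$ matter). The QCQP is: minimize $(\mathbf{r}^0)^T\mathbf{x}+\langle \mathbf{Q}^0,\mathbf{W}\rangle$ over $(\mathbf{x},\mathbf{W})\in\mathcal{F}$ subject to $W_{ij}=x_ix_j$ for $(i,j)\in\mathcal{B}$ and $W_{kk}=x_k^2$ for $k\in\mathcal{Q}$, where $\mathcal{F}=\{(\mathbf{x},\mathbf{W})\in[0,1]^n\times\mathcal{S}^n : (\mathbf{r}^i)^T\mathbf{x}+\langle\mathbf{Q}^i,\mathbf{W}\rangle\le b_i,\ i\in[m]\}$. It is assumed feasible. Let $\mathcal{NC}$ be the set of indices of variables occurring in some pair of $\mathcal{B}$ or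 in $\mathcal{Q}$; w.l.o.g. $\mathcal{NC}=\{1,\dots,|\mathcal{NC}|\}$. Partitions. Fix an integer $d\ge1$. Let $\mathcal{P}_d=\{\mathbf{P}\in[0,1]^{|\mathcal{NC}|\times(d+2)} : 0=P_{i1}\le P_{i2}\le\dots\le P_{i(d+1)}\le P_{i(d+2)}=1,\ \forall i\in\mathcal{NC}\}$ and $\mathcal{Y}=\{\mathbf{Y}\in\{0,1\}^{|\mathcal{NC}|\times(d+1)}:\sum_{l=1}^{d+1}Y_{il}=1,\ \forall i\in\mathcal{NC}\}$. Derivatives with respect to $\mathbf{P}$ are taken only with respect to the ''unfixed'' entries $P_{i2},\dots,P_{i(d+1)}$, $i\in\mathcal{NC}$. Value functions. For $\mathbf{P}\in\mathcal{P}_d$, $\mathbf{Y}\in\mathcal{Y}$, let $v(\mathbf{P},\mathbf{Y})$ be the optimal value ($+\infty$ if infeasible) of the linear program: minimize $(\mathbf{r}^0)^T\mathbf{x}+\langle\mathbf{Q}^0,\mathbf{W}\rangle$ over $(\mathbf{x},\mathbf{W})\in\mathcal{F}$, $\boldsymbol\Lambda^{ij}\in\mathbb{R}_+^{(d+2)\times(d+2)}$ for $(i,j)\in\mathcal{B}$, $\boldsymbol\Lambda^k\in\mathbb{R}_+^{d+2}$ for $k\in\mathcal{Q}$, subject to: (A) for each $(i,j)\in\mathcal{B}$: $x_i=\sum_{k,l=1}^{d+2}\Lambda^{ij}_{kl}P_{il}$, $x_j=\sum_{k,l}\Lambda^{ij}_{kl}P_{jk}$, $W_{ij}=\sum_{k,l}\Lambda^{ij}_{kl}P_{il}P_{jk}$,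 $\sum_{k,l}\Lambda^{ij}_{kl}=1$; (B) for each $(i,j)\in\mathcal{B}$: $\sum_{k}\Lambda^{ij}_{k1}\le Y_{i1}$, $\sum_k\Lambda^{ij}_{k(d+2)}\le Y_{i(d+1)}$, $\sum_k\Lambda^{ij}_{k(l+1)}\le Y_{il}+Y_{i(l+1)}$ for $l\in[d]$, and $\sum_l\Lambda^{ij}_{1l}\le Y_{j1}$, $\sum_l\Lambda^{ij}_{(d+2)l}\le Y_{j(d+1)}$, $\sum_l\Lambda^{ij}_{(k+1)l}\le Y_{jk}+Y_{j(k+1)}$ for $k\in[d]$; (C) for each $k\in\mathcal{Q}$: $x_k=\sum_{l=1}^{d+2}\Lambda^k_lP_{kl}$, $W_{kk}\le\sum_{l=1}^{d+2}\Lambda^k_l(P_{kl})^2$, $\sum_{l=1}^{d+2}\Lambda^k_l=1$, and $W_{kk}\ge 2\alpha^k_jx_k-(\alpha^k_j)^2$ for all $j\in\mathcal{J}_k$, where $\{\alpha^k_j\}_{j\in\mathcal{J}_k}\subset[0,1]$ is a finite set of points consisting of $P_{k1},\dots,P_{k(d+2)}$ and possibly further points fixed independently of $\mathbf{P}$; (D) for each $k\in\mathcal{Q}$: $\Lambda^k_1\le Y_{k1}$, $\Lambda^k_{d+2}\le Y_{k(d+1)}$, $\Lambda^k_{l+1}\le Y_{kl}+Y_{k(l+1)}$ for $l\in[d]$. The piecewise McCormick outer-approximation problem at $\mathbf{P}$ is the minimization over $\mathbf{Y}\in\mathcal{Y}$ as well, with optimal value $\underline{v}(\mathbf{P})=\min_{\mathbf{Y}\in\mathcal{Y}}v(\mathbf{P},\mathbf{Y})$.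 Abstract LP form. Adding one slack variable per inequality, the LP is written as $v(\mathbf{P},\mathbf{Y})=\min_{\mathbf{z}\ge\mathbf{0}}\{\mathbf{c}^T\mathbf{z}:\mathbf{M}(\mathbf{P})\mathbf{z}=\mathbf{d}(\mathbf{P}),\ \bar{\mathbf{M}}\mathbf{z}=\bar{\mathbf{B}}\,\mathrm{vec}(\mathbf{Y})\}$, where $\mathbf{z}$ comprises $\mathbf{x}$, $\mathbf{W}$ (entries in $\mathcal{B},\mathcal{Q}$), $\boldsymbol\Lambda$, and slacks; $\mathbf{M}(\mathbf{P})\in\mathbb{R}^{n_r\times n_c}$, $\mathbf{d}(\mathbf{P})\in\mathbb{R}^{n_r}$ represent the constraints defining $\mathcal{F}$ (including $x_i\le1$), (A) and (C); and $\bar{\mathbf{M}}\mathbf{z}=\bar{\mathbf{B}}\,\mathrm{vec}(\mathbf{Y})$ represents (B) and (D). The entries of $\mathbf{M}$ and $\mathbf{d}$ are polynomials in $\mathbf{P}$. Dual sign convention: dual solutions are optimal Lagrange multipliers for the Lagrangian $\mathbf{c}^T\mathbf{z}+\boldsymbol\pi^T(\mathbf{M}(\mathbf{P})\mathbf{z}-\mathbf{d}(\mathbf{P}))+\bar{\boldsymbol\pi}^T(\bar{\mathbf{M}}\mathbf{z}-\bar{\mathbf{B}}\,\mathrm{vec}(\mathbf{Y}))$ over $\mathbf{z}\ge\mathbf{0}$. *)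

(* Defs.v *)
From HB Require Import structures.
From mathcomp Require Import all_boot all_order all_algebra.
From mathcomp Require Import all_classical all_reals all_analysis.

Set Implicit Arguments.
Unset Strict Implicit.
Unset Printing Implicit Defensive.

Import Order.TTheory GRing.Theory Num.Theory.
Import numFieldNormedType.Exports.

Local Open Scope classical_set_scope.
Local Open Scope ring_scope.

Definition affine_hull (R : realType) (V : lmodType R) (A : set V) : set V :=
  [set x | exists (N : nat) (a : 'I_N -> R) (u : 'I_N -> V),
     [/\ \sum_k a k = 1, forall k, A (u k) & x = \sum_k a k *: u k]].

Definition relint (R : realType) (p q : nat) (A : set 'M[R]_(p, q)) :
    set 'M[R]_(p, q) :=
  [set x | A x /\ \forall y \near x, affine_hull A y -> A y].

Definition is_minimizer (R : realType) (T : Type) (S : set T)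
    (f : T -> \bar R) (x : T) : Prop :=
  S x /\ forall y, S y -> (f x <= f y)%E.

Definition unique_minimizer (R : realType) (T : Type) (S : set T)
    (f : T -> \bar R) (x : T) : Prop :=
  is_minimizer S f x /\ forall y, is_minimizer S f y -> y = x.

Definition partial (R : realType) (p q : nat) (f : 'M[R]_(p, q) -> R)
    (P : 'M[R]_(p, q)) (i : 'I_p) (j : 'I_q) : R :=
  derive1 (fun t : R => f (P + t *: delta_mx i j)) 0.

(* The partial derivative of an extended-real function exists and equals D;
   this includes finiteness of f along the coordinate line close to P. *)
Definition has_partial (R : realType) (p q : nat) (f : 'M[R]_(p, q) -> \bar R)
    (P : 'M[R]_(p, q)) (i : 'I_p) (j : 'I_q) (D : R) : Prop :=
  (\forall t \near (0 : R), f (P + t *: delta_mx i j) \is a fin_num) /\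
  is_derive (0 : R) (1 : R) (fun t : R => fine (f (P + t *: delta_mx i j))) D.

Definition frob (R : realType) (p q : nat) (A B : 'M[R]_(p, q)) : R :=
  \sum_i \sum_j A i j * B i j.

(* Linear programs min { c^T z : z >= 0, A z = b, Ab z = bb } with the equality
   constraints split into two blocks. *)
Section StandardLP.
Context {R : realType} {nr nrb nc : nat}.
Variables (c : 'cV[R]_nc) (A : 'M[R]_(nr, nc)) (b : 'cV[R]_nr).
Variables (Ab : 'M[R]_(nrb, nc)) (bb : 'cV[R]_nrb).

Definition nonneg_vec : set 'cV[R]_nc := [set z | forall l, 0 <= z l 0].

Definition std_feasible : set 'cV[R]_nc :=
  [set z | [/\ nonneg_vec z, A *m z = b & Ab *m z = bb]].

Definition primal_solution (z : 'cV[R]_nc) : Prop :=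
  is_minimizer std_feasible (fun z => (frob c z)%:E) z.

Definition unique_primal_solution (z : 'cV[R]_nc) : Prop :=
  primal_solution z /\ forall z', primal_solution z' -> z' = z.

Definition lagrangian (z : 'cV[R]_nc) (pi : 'cV[R]_nr) (pib : 'cV[R]_nrb) : R :=
  frob c z + frob pi (A *m z - b) + frob pib (Ab *m z - bb).

Definition dual_function (pi : 'cV[R]_nr) (pib : 'cV[R]_nrb) : \bar R :=
  ereal_inf [set (lagrangian z pi pib)%:E | z in nonneg_vec].

Definition dual_solution (pi : 'cV[R]_nr) (pib : 'cV[R]_nrb) : Prop :=
  (-oo < dual_function pi pib)%E /\
  forall pi' pib', (dual_function pi' pib' <= dual_function pi pib)%E.

(* Only the block pi of the multipliers is required to be unique. Rows of the
   form L + s = 0 in the second block always leave their own multiplier free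
   to increase, so asking for a unique pair (pi, pib) would be unsatisfiable
   for the programs below. *)
Definition unique_dual_solution (pi : 'cV[R]_nr) : Prop :=
  (exists pib, dual_solution pi pib) /\
  forall pi' pib', dual_solution pi' pib' -> pi' = pi.

End StandardLP.

(* There are nc + nl variables. The first nc of them are those occurring in a
   bilinear or square term. Index ord0 in lin and quad is the objective, index
   lift ord0 i is the i-th constraint. *)
Record qcqp (R : realType) (m nc nl : nat) := QCQP {
  rhs : 'I_m -> R;
  lin : 'I_m.+1 -> 'cV[R]_(nc + nl);
  quad : 'I_m.+1 -> 'M[R]_(nc + nl);
  bil : {set 'I_nc * 'I_nc};
  sq : {set 'I_nc}
}.

Section Problem.
Context {R : realType} {m nc nl : nat}.
Variable D : qcqp R m nc nl.

Local Notation n := (nc + nl)%N.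
Local Notation vr := (@lshift nc nl).

Definition qcqp_wf : Prop :=
  [/\ forall s, (quad D s)^T = quad D s,
      forall e, e \in bil D -> (e.1 < e.2)%N,
      forall s (i j : 'I_n), (i < j)%N -> quad D s i j != 0 ->
        exists2 e, e \in bil D & i = vr e.1 /\ j = vr e.2,
      forall s (i : 'I_n), quad D s i i != 0 -> exists2 k, k \in sq D & i = vr k
    & forall i : 'I_nc, i \in sq D \/
        exists j, (i, j) \in bil D \/ (j, i) \in bil D].

Definition form (s : 'I_m.+1) (x : 'cV[R]_n) (W : 'M[R]_n) : R :=
  frob (lin D s) x + frob (quad D s) W.

Definition calF : set ('cV[R]_n * 'M[R]_n) :=
  [set xW : 'cV[R]_n * 'M[R]_n | [/\ forall i, 0 <= xW.1 i 0 <= 1,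
                xW.2^T = xW.2
              & forall i : 'I_m, form (lift ord0 i) xW.1 xW.2 <= rhs D i]].

Definition qcqp_feasible : Prop :=
  exists xW : 'cV[R]_n * 'M[R]_n, [/\ calF xW,
    forall e, e \in bil D ->
      xW.2 (vr e.1) (vr e.2) = xW.1 (vr e.1) 0 * xW.1 (vr e.2) 0
  & forall k, k \in sq D -> xW.2 (vr k) (vr k) = xW.1 (vr k) 0 ^+ 2].

Variable d : nat.
(* beta k lists the tangent points for x_k which do not depend on P. *)
Variable beta : 'I_nc -> seq R.

Definition calP : set 'M[R]_(nc, d.+2) :=
  [set P | [/\ forall i j, 0 <= P i j <= 1,
               forall i, P i ord0 = 0,
               forall i, P i ord_max = 1
             & forall i (j k : 'I_d.+2), (j <= k)%N -> P i j <= P i k]].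

(* Binary matrices are boolean; they are cast to R where they enter the LP. *)
Definition calY : {set 'M[bool]_(nc, d.+1)} :=
  [set Y : 'M[bool]_(nc, d.+1) | [forall i, (\sum_l Y i l)%N == 1%N]].

Definition realY (Y : 'M[bool]_(nc, d.+1)) : 'M[R]_(nc, d.+1) :=
  map_mx (fun y : bool => y%:R) Y.

(* Sum of Y_i over the intervals having the l-th partition point as an end
   point: the interval of index t has end points of index t and t.+1. *)
Definition adjY (Y : 'M[R]_(nc, d.+1)) (i : 'I_nc) (l : 'I_d.+2) : R :=
  \sum_(t < d.+1 | (t == l :> nat) || (t.+1 == l :> nat)) Y i t.

Definition tan_idx (k : 'I_nc) : Type := ('I_d.+2 + 'I_(size (beta k)))%type.
HB.instance Definition _ k := Finite.on (tan_idx k).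

Definition alpha (P : 'M[R]_(nc, d.+2)) (k : 'I_nc) (j : tan_idx k) : R :=
  match j with inl l => P k l | inr t => (beta k)`_t end.

(* The entries of L2 e for e not in bil D, and of L1 k for k not in sq D, are
   unconstrained and do not enter the objective. *)
Definition pmr_feasible (P : 'M[R]_(nc, d.+2)) (Y : 'M[R]_(nc, d.+1))
    (x : 'cV[R]_n) (W : 'M[R]_n)
    (L2 : 'I_nc * 'I_nc -> 'M[R]_(d.+2)) (L1 : 'I_nc -> 'rV[R]_(d.+2)) : Prop :=
  calF (x, W) /\
  (forall e, e \in bil D ->
   [/\ forall k l, 0 <= L2 e k l,
       [/\ x (vr e.1) 0 = \sum_k \sum_l L2 e k l * P e.1 l,
           x (vr e.2) 0 = \sum_k \sum_l L2 e k l * P e.2 k,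
           W (vr e.1) (vr e.2) = \sum_k \sum_l L2 e k l * P e.1 l * P e.2 k
         & \sum_k \sum_l L2 e k l = 1],
       forall l, \sum_k L2 e k l <= adjY Y e.1 l
     & forall k, \sum_l L2 e k l <= adjY Y e.2 k]) /\
  (forall k, k \in sq D ->
   [/\ forall l, 0 <= L1 k 0 l,
       [/\ x (vr k) 0 = \sum_l L1 k 0 l * P k l,
           W (vr k) (vr k) <= \sum_l L1 k 0 l * P k l ^+ 2
         & \sum_l L1 k 0 l = 1],
       forall j : tan_idx k,
         2 * alpha P j * x (vr k) 0 - alpha P j ^+ 2 <= W (vr k) (vr k)
     & forall l, L1 k 0 l <= adjY Y k l]).

Definition value (P : 'M[R]_(nc, d.+2)) (Y : 'M[bool]_(nc, d.+1)) : \bar R :=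
  ereal_inf [set o | exists x W L2 L1,
    pmr_feasible P (realY Y) x W L2 L1 /\ o = (form ord0 x W)%:E].

Definition lower_value (P : 'M[R]_(nc, d.+2)) : \bar R :=
  \big[Order.min/+oo%E]_(Y in calY) value P Y.

Definition bilI : Type := {e : 'I_nc * 'I_nc | e \in bil D}.
Definition sqI : Type := {k : 'I_nc | k \in sq D}.
HB.instance Definition _ := Finite.on bilI.
HB.instance Definition _ := Finite.on sqI.

Inductive eq_row :=
  | EqXi of bilI | EqXj of bilI | EqW of bilI | EqSum of bilI
  | EqXk of sqI | EqSumk of sqI.

Inductive ineq_row :=
  | IneqF of 'I_m | IneqUb of 'I_n | IneqSq of sqI
  | IneqTan (k : sqI) of tan_idx (val k).

Inductive link_row :=
  | LinkI of bilI & 'I_d.+2 | LinkJ of bilI & 'I_d.+2 | LinkK of sqI & 'I_d.+2.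

(* Slack variables are indexed by the inequalities they belong to. *)
Inductive lp_col :=
  | ColX of 'I_n | ColWb of bilI | ColWs of sqI
  | ColL2 of bilI & 'I_d.+2 & 'I_d.+2 | ColL1 of sqI & 'I_d.+2
  | ColSlack of ineq_row | ColLinkSlack of link_row.

Definition eq_row_code (r : eq_row) : bilI + bilI + (bilI + bilI) + (sqI + sqI) :=
  match r with
  | EqXi e => inl (inl (inl e)) | EqXj e => inl (inl (inr e))
  | EqW e => inl (inr (inl e)) | EqSum e => inl (inr (inr e))
  | EqXk k => inr (inl k) | EqSumk k => inr (inr k)
  end.
Definition eq_row_decode (c : bilI + bilI + (bilI + bilI) + (sqI + sqI)) : eq_row :=
  match c with
  | inl (inl (inl e)) => EqXi e | inl (inl (inr e)) => EqXj e
  | inl (inr (inl e)) => EqW e | inl (inr (inr e)) => EqSum e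
  | inr (inl k) => EqXk k | inr (inr k) => EqSumk k
  end.
Lemma eq_row_codeK : cancel eq_row_code eq_row_decode. Proof. by case. Qed.
HB.instance Definition _ := Finite.copy eq_row (can_type eq_row_codeK).

Definition ineq_row_code (r : ineq_row) :
    'I_m + 'I_n + (sqI + {k : sqI & tan_idx (val k)}) :=
  match r with
  | IneqF i => inl (inl i) | IneqUb i => inl (inr i)
  | IneqSq k => inr (inl k) | IneqTan k j => inr (inr (existT _ k j))
  end.
Definition ineq_row_decode
    (c : 'I_m + 'I_n + (sqI + {k : sqI & tan_idx (val k)})) : ineq_row :=
  match c with
  | inl (inl i) => IneqF i | inl (inr i) => IneqUb i
  | inr (inl k) => IneqSq k | inr (inr (existT k j)) => IneqTan j
  end.
Lemma ineq_row_codeK : cancel ineq_row_code ineq_row_decode. Proof. by case. Qed.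
HB.instance Definition _ := Finite.copy ineq_row (can_type ineq_row_codeK).

Definition link_row_code (r : link_row) :
    bilI * 'I_d.+2 + bilI * 'I_d.+2 + sqI * 'I_d.+2 :=
  match r with
  | LinkI e l => inl (inl (e, l)) | LinkJ e l => inl (inr (e, l))
  | LinkK k l => inr (k, l)
  end.
Definition link_row_decode
    (c : bilI * 'I_d.+2 + bilI * 'I_d.+2 + sqI * 'I_d.+2) : link_row :=
  match c with
  | inl (inl (e, l)) => LinkI e l | inl (inr (e, l)) => LinkJ e l
  | inr (k, l) => LinkK k l
  end.
Lemma link_row_codeK : cancel link_row_code link_row_decode. Proof. by case. Qed.
HB.instance Definition _ := Finite.copy link_row (can_type link_row_codeK).

Local Notation lp_col_cod :=
  ('I_n + bilI + sqI + (bilI * 'I_d.+2 * 'I_d.+2 + sqI * 'I_d.+2)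
   + (ineq_row + link_row))%type.
Definition lp_col_code (c : lp_col) : lp_col_cod :=
  match c with
  | ColX i => inl (inl (inl (inl i))) | ColWb e => inl (inl (inl (inr e)))
  | ColWs k => inl (inl (inr k)) | ColL2 e k l => inl (inr (inl (e, k, l)))
  | ColL1 k l => inl (inr (inr (k, l)))
  | ColSlack r => inr (inl r) | ColLinkSlack r => inr (inr r)
  end.
Definition lp_col_decode (c : lp_col_cod) : lp_col :=
  match c with
  | inl (inl (inl (inl i))) => ColX i | inl (inl (inl (inr e))) => ColWb e
  | inl (inl (inr k)) => ColWs k | inl (inr (inl (e, k, l))) => ColL2 e k l
  | inl (inr (inr (k, l))) => ColL1 k l
  | inr (inl r) => ColSlack r | inr (inr r) => ColLinkSlack r
  end.
Lemma lp_col_codeK : cancel lp_col_code lp_col_decode. Proof. by case. Qed.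
HB.instance Definition _ := Finite.copy lp_col (can_type lp_col_codeK).

Definition lp_row : Type := (eq_row + ineq_row)%type.
HB.instance Definition _ := Finite.on lp_row.

(* The left-hand sides below are linear in z, and the matrices of the standard
   form collect their values on the unit vectors. *)
Definition xvec (z : lp_col -> R) : 'cV[R]_n := \col_i z (ColX i).

Definition Wmat (z : lp_col -> R) : 'M[R]_n :=
  \sum_(e : bilI) z (ColWb e) *:
    (delta_mx (vr (val e).1) (vr (val e).2) + delta_mx (vr (val e).2) (vr (val e).1))
  + \sum_(k : sqI) z (ColWs k) *: delta_mx (vr (val k)) (vr (val k)).

Definition eq_lhs (P : 'M[R]_(nc, d.+2)) (z : lp_col -> R) (r : eq_row) : R :=
  match r with
  | EqXi e => z (ColX (vr (val e).1))
              - \sum_k \sum_l z (ColL2 e k l) * P (val e).1 l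
  | EqXj e => z (ColX (vr (val e).2))
              - \sum_k \sum_l z (ColL2 e k l) * P (val e).2 k
  | EqW e => z (ColWb e)
             - \sum_k \sum_l z (ColL2 e k l) * P (val e).1 l * P (val e).2 k
  | EqSum e => \sum_k \sum_l z (ColL2 e k l)
  | EqXk k => z (ColX (vr (val k))) - \sum_l z (ColL1 k l) * P (val k) l
  | EqSumk k => \sum_l z (ColL1 k l)
  end.

Definition eq_rhs (r : eq_row) : R :=
  match r with EqSum _ | EqSumk _ => 1 | _ => 0 end.

Definition ineq_lhs (P : 'M[R]_(nc, d.+2)) (z : lp_col -> R) (r : ineq_row) : R :=
  match r with
  | IneqF i => form (lift ord0 i) (xvec z) (Wmat z)
  | IneqUb i => z (ColX i)
  | IneqSq k => z (ColWs k) - \sum_l z (ColL1 k l) * P (val k) l ^+ 2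
  | IneqTan k j => 2 * alpha P j * z (ColX (vr (val k))) - z (ColWs k)
  end.

Definition ineq_rhs (P : 'M[R]_(nc, d.+2)) (r : ineq_row) : R :=
  match r with
  | IneqF i => rhs D i
  | IneqUb _ => 1
  | IneqSq _ => 0
  | IneqTan k j => alpha P j ^+ 2
  end.

Definition link_lhs (z : lp_col -> R) (r : link_row) : R :=
  match r with
  | LinkI e l => \sum_k z (ColL2 e k l)
  | LinkJ e k => \sum_l z (ColL2 e k l)
  | LinkK k l => z (ColL1 k l)
  end.

Definition link_rhs (Y : 'M[R]_(nc, d.+1)) (r : link_row) : R :=
  match r with
  | LinkI e l => adjY Y (val e).1 l
  | LinkJ e k => adjY Y (val e).2 k
  | LinkK k l => adjY Y (val k) l
  end.

Definition row_lhs (P : 'M[R]_(nc, d.+2)) (z : lp_col -> R) (r : lp_row) : R :=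
  match r with
  | inl r => eq_lhs P z r
  | inr r => ineq_lhs P z r + z (ColSlack r)
  end.

Definition row_rhs (P : 'M[R]_(nc, d.+2)) (r : lp_row) : R :=
  match r with inl r => eq_rhs r | inr r => ineq_rhs P r end.

Definition unit_col (l : 'I_#|{: lp_col}|) (c : lp_col) : R := (c == enum_val l)%:R.

Definition costc : 'cV[R]_#|{: lp_col}| :=
  \col_l form ord0 (xvec (unit_col l)) (Wmat (unit_col l)).

Definition matM (P : 'M[R]_(nc, d.+2)) : 'M[R]_(#|{: lp_row}|, #|{: lp_col}|) :=
  \matrix_(k, l) row_lhs P (unit_col l) (enum_val k).

Definition vecd (P : 'M[R]_(nc, d.+2)) : 'cV[R]_#|{: lp_row}| :=
  \col_k row_rhs P (enum_val k).

Definition matMbar : 'M[R]_(#|{: link_row}|, #|{: lp_col}|) :=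
  \matrix_(k, l) (link_lhs (unit_col l) (enum_val k)
                  + unit_col l (ColLinkSlack (enum_val k))).

Definition matBbar : 'M[R]_(#|{: link_row}|, nc * d.+1) :=
  \matrix_(k, t) link_rhs (vec_mx (delta_mx 0 t)) (enum_val k).

Definition vecY (Y : 'M[bool]_(nc, d.+1)) : 'cV[R]_(nc * d.+1) :=
  (mxvec (realY Y))^T.

End Problem.

(* Main.v *)
Require Import Defs.
From mathcomp Require Import all_boot all_order all_algebra.
From mathcomp Require Import all_classical all_reals all_analysis.
From mathcomp Require Import ring lra.

Import Order.TTheory GRing.Theory Num.Theory.
Import numFieldNormedType.Exports.

Local Open Scope classical_set_scope.
Local Open Scope ring_scope.

(** Fix the binary matrix Ys and move one entry of the partition by t, so that
the matrices A(t) = M(P + t E) and b(t) = d(P + t E) vary smoothly while the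
link rows Mbar z = Bbar vec(Ys) do not move. Write v0 for the optimal value at
t = 0 and g for the asserted derivative. Everything follows from the two
estimates v0 + t g - e|t| <= v(t) <= v0 + t g + e|t| for small t.

Lower estimate ([feasible_lower]). A feasible z at parameter t satisfies, by
weak duality with a dual solution of the unperturbed program,
c z >= v0 + pis ((A(t) - A(0)) z - (b(t) - b(0))). The feasible sets are
uniformly bounded, hence cheap feasible points accumulate at an optimal point
for t = 0, which is zs by uniqueness; so the right-hand side is
v0 + t g + o(t).

Upper estimate ([feasible_upper]). If no feasible point at t costs at most
v0 + t g + e|t|, Farkas' lemma provides a multiplier (lam, pi, pib) proving it
([lp_alternative]). Normalized multipliers have a limit as t tends to 0, and
this limit certifies that v0 is optimal at t = 0. Uniqueness of the dual block
pis then forces pi = lam pis with lam > 0 ([certificate_is_multiple]), and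
evaluating the certificates at zs contradicts the definition of g.

The multipliers pib of the link rows are not unique: a link row with
right-hand side 0 forces all its variables to vanish, and its multiplier may
grow without bound. So certificates are tested only on those z >= 0 at
which such rows vanish, and their multipliers on these rows are set to 0. The
other link rows have a positive right-hand side and a slack variable, and this
keeps their multipliers under control.

The limits are taken along ultrafilters finer than the punctured neighbourhoods
of 0: every bounded real function converges along an ultrafilter, so no
sequence has to be extracted ([near0_ultra], [ultra_bounded_cvg]).

For the lower value, the values at the finitely many Y <> Ys exceed v0 by a
gap, and the same compactness argument shows that the gap persists for small t
([infeasible_near]); so the minimum over Y is attained at Ys near P. Finally,
P + t E stays in the set of partitions because P is in the relative interior
([calP_line]), and on that set the relaxation and its standard form have the
same values ([value_le], [value_ge]). *)

(** * Farkas' lemma *)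

Lemma frobE {R : realType} {n} (u v : 'cV[R]_n) : frob u v = (u^T *m v) 0 0.
Proof. by rewrite mxE /frob; apply: eq_bigr => i _; rewrite big_ord1 mxE. Qed.

Lemma frob_sum {R : realType} {n} (u v : 'cV[R]_n) :
  frob u v = \sum_i u i 0 * v i 0.
Proof. by apply: eq_bigr => i _; rewrite big_ord1. Qed.

Lemma frobDl {R : realType} {n} (u v w : 'cV[R]_n) :
  frob (u + v) w = frob u w + frob v w.
Proof. by rewrite !frobE linearD mulmxDl mxE. Qed.

Lemma frobDr {R : realType} {n} (u v w : 'cV[R]_n) :
  frob u (v + w) = frob u v + frob u w.
Proof. by rewrite !frobE mulmxDr mxE. Qed.

Lemma frobBr {R : realType} {n} (u v w : 'cV[R]_n) :
  frob u (v - w) = frob u v - frob u w.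
Proof. by rewrite !frobE mulmxBr !mxE. Qed.

Lemma frobZl {R : realType} {n} (a : R) (u v : 'cV[R]_n) :
  frob (a *: u) v = a * frob u v.
Proof. by rewrite !frobE linearZ /= -scalemxAl mxE. Qed.

Lemma frobZr {R : realType} {n} (a : R) (u v : 'cV[R]_n) :
  frob u (a *: v) = a * frob u v.
Proof. by rewrite !frobE -scalemxAr mxE. Qed.

(** Induction on the number of columns, after Bartl. To add a column a to A, the
induction hypothesis for A suffices unless some row x has x A >= 0 and x b < 0,
and then x a < 0. The induction hypothesis applies to Q A and Q b, where
Q = 1 - (x a)^-1 a x kills a; the defect b - A u is then a multiple of a, and
applying x to it shows that the factor is nonnegative. *)
Lemma farkas {R : realFieldType} {p n} (A : 'M[R]_(p, n)) (b : 'cV[R]_p) :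
  (forall y : 'rV_p, (forall j, 0 <= (y *m A) 0 j) -> 0 <= (y *m b) 0 0) ->
  exists2 u : 'cV_n, (forall j, 0 <= u j 0) & A *m u = b.
Proof.
elim: n => [|n IHn] in A b *.
  move=> H; exists 0; first by case.
  have pos (y : 'rV[R]_p) : 0 <= (y *m b) 0 0 by apply: H; case.
  rewrite mulmx0; apply/colP => i; rewrite mxE; apply/esym/eqP.
  have := pos (- delta_mx 0 i); have := pos (delta_mx 0 i).
  by rewrite mulNmx -rowE !mxE oppr_ge0 eq_le => -> ->.
move: A; rewrite -[n.+1]/(1 + n)%N => A.
rewrite -(hsubmxK A); move: (lsubmx A) (rsubmx A) => {A} a A H.
have [[x [xA xb]]|no] := pselect (exists x : 'rV_p,
    (forall j, 0 <= (x *m A) 0 j) /\ (x *m b) 0 0 < 0); last first.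
  have [y yA|u u0 Au] := IHn A b.
    by rewrite leNgt; apply/negP => yb; apply: no; exists y.
  exists (col_mx 0 u); last by rewrite mul_row_col mulmx0 add0r.
  by move=> j; rewrite mxE; case: splitP => k _ //; rewrite mxE.
pose s := (x *m a) 0 0.
have s0 : s < 0.
  rewrite ltNge; apply/negP => s0; move: xb; rewrite ltNge => /negP; apply.
  apply: H => j; rewrite mul_mx_row mxE; case: splitP => k _ //.
  by rewrite ord1.
have xaE : x *m a = s%:M by rewrite [LHS]mx11_scalar.
pose Q : 'M[R]_p := 1%:M - s^-1 *: (a *m x).
have Qa : Q *m a = 0.
  rewrite mulmxBl mul1mx -scalemxAl -mulmxA xaE mul_mx_scalar scalerA.
  by rewrite mulVf ?lt_eqF // scale1r subrr.
have [y yA|u u0 Au] := IHn (Q *m A) (Q *m b).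
  rewrite mulmxA; apply: H => j; rewrite mul_mx_row mxE.
  case: splitP => k _; last by rewrite -mulmxA.
  by rewrite -mulmxA Qa mulmx0 mxE.
pose w := s^-1 *: (x *m (b - A *m u)).
exists (col_mx w u).
  move=> j; rewrite mxE; case: splitP => k _ //.
  have xAu : 0 <= (x *m (A *m u)) 0 0.
    by rewrite mulmxA mxE; apply: sumr_ge0 => i _; apply: mulr_ge0.
  rewrite ord1 /w mulmxBr; move: xb xAu; move: (x *m (_ *m _)) (x *m b) => C B xb xAu.
  rewrite !mxE; apply: mulr_le0; first by rewrite invr_le0 ltW.
  by rewrite subr_le0; apply: le_trans xAu; apply: ltW.
move/esym/eqP: Au; rewrite -mulmxA -subr_eq0 -mulmxBr /Q mulmxBl mul1mx.
rewrite subr_eq0 mul_row_col /w -scalemxAr mulmxA -scalemxAl => /eqP <-.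
by rewrite subrK.
Qed.

(** Farkas' lemma for the system c z + s = r, A z = b, Ab z = bb with z, s >= 0;
lam is the multiplier of the cost row, and its sign comes from the column of s. *)
Lemma lp_alternative {R : realType} {nr nrb nc} (c : 'cV[R]_nc)
    (A : 'M[R]_(nr, nc)) (b : 'cV[R]_nr) (Ab : 'M[R]_(nrb, nc))
    (bb : 'cV[R]_nrb) (r : R) :
  (forall z, std_feasible A b Ab bb z -> r < frob c z) ->
  exists lam pi pib, [/\ 0 <= lam,
    forall z, nonneg_vec z ->
      0 <= lam * frob c z + frob pi (A *m z) + frob pib (Ab *m z)
    & lam * r + frob pi b + frob pib bb < 0].
Proof.
move=> lb; apply: contrapT => no.
pose F := block_mx (1%:M : 'M[R]_1) c^T 0 (col_mx A Ab).
pose f := col_mx r%:M (col_mx b bb).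
have [y yF|u u0] := farkas F f.
  rewrite leNgt; apply/negP => yf; apply: no.
  move: yF yf; rewrite /F /f -(hsubmxK y) -(hsubmxK (rsubmx y)).
  move: (lsubmx y) (lsubmx (rsubmx y)) (rsubmx (rsubmx y)) => l p q.
  rewrite mul_row_block mulmx1 mulmx0 addr0 !mul_row_col addrA.
  rewrite mul_mx_scalar => yF yf.
  exists (l 0 0), p^T, q^T; split.
  - by have := yF (lshift _ 0); rewrite row_mxEl.
  - move=> z z0.
    suff -> : l 0 0 * frob c z + frob p^T (A *m z) + frob q^T (Ab *m z)
       = ((l *m c^T + p *m A + q *m Ab) *m z) 0 0.
      rewrite mxE; apply: sumr_ge0 => j _; apply: mulr_ge0 => //.
      by have := yF (rshift _ j); rewrite row_mxEr.
    rewrite !frobE !trmxK !mulmxDl [X in X *m c^T]mx11_scalar mul_scalar_mx.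
    rewrite -scalemxAl -!mulmxA; move: (c^T *m z) (A *m z) (Ab *m z) => C p' q'.
    by rewrite !mxE.
  - rewrite !frobE !trmxK [l 0 0 * r]mulrC -addrA; move: yf.
    by move: (p *m b) (q *m bb) => B B'; rewrite !mxE.
rewrite -(vsubmxK u) /F /f mul_block_col mul1mx mul0mx add0r mul_col_mx.
move=> /eq_col_mx [cz /eq_col_mx [Az Bz]].
have /lb : std_feasible A b Ab bb (dsubmx u).
  by split => // l; rewrite mxE.
rewrite frobE => /lt_geF/negbT/negP; apply.
have := congr1 (fun M : 'M[R]_1 => M 0 0) cz; rewrite /= !mxE eqxx mulr1n => <-.
by rewrite lerDr.
Qed.

(** * Limits along ultrafilters *)

Lemma ultra_fmap {S T : Type} (f : S -> T) (F : set_system S) :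
  UltraFilter F -> UltraFilter (f @ F).
Proof.
move=> FU; split => [|G GF FG]; first exact: fmap_proper_filter.
rewrite predeqE => A; split=> [GA|]; last exact: FG.
have [//|FnA] := in_ultra_setVsetC (f @^-1` A) FU.
have /filter_ex[x [Ax nAx]] : G (A `&` ~` A) by apply: filterI => //; apply: FG.
by case: nAx.
Qed.

Lemma ultra_bounded_cvg {R : realType} {T : Type} (F : set_system T)
    (f : T -> R) (K : R) :
  UltraFilter F -> (\forall x \near F, `|f x| <= K) ->
  exists l : R, f x @[x --> F] --> l.
Proof.
move=> FU fK; have := @segment_compact R (- K) K.
rewrite compact_ultra => /(_ (f @ F)) []; first exact: ultra_fmap.
  by apply: filterS fK => x; rewrite /= in_itv /= ler_norml.
by move=> l [_ fl]; exists l.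
Qed.

(** If Q fails at points accumulating at 0, these points are nonzero, and some
ultrafilter tending to 0 is concentrated on them. *)
Lemma near0_ultra {R : realType} (Q : R -> Prop) :
  Q 0 ->
  (forall F : set_system R, UltraFilter F -> F --> (0 : R)^' ->
     (\forall t \near F, ~ Q t) -> False) ->
  \forall t \near (0 : R), Q t.
Proof.
move=> Q0 H; apply: contrapT => nQ.
pose G := within [set t | ~ Q t] (0 : R)^'.
have GP : ProperFilter G.
  split; last exact: within_filter.
  rewrite /G /within /= => H0; apply: nQ.
  have : \forall t \near (0:R), t != 0 -> Q t.
    move: H0; apply: (@filterS _ (nbhs (0 : R))) => t h t0; apply: contrapT; exact: h.
  by apply: (@filterS _ (nbhs (0 : R))) => t ht;
    have [->|t0] := eqVneq t 0; [exact: Q0|exact: ht].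
have [F [FU GF]] := ultraFilterLemma GP.
apply: (H F FU).
  by apply: cvg_trans GF _; exact: cvg_within.
by apply: GF; rewrite /G /within /=; near=> t.
Unshelve. all: by end_near. Qed.

Lemma cvg_sumr {R : realType} {T : Type} (F : set_system T) {FF : Filter F}
    {I : finType} (f : I -> T -> R) (l : I -> R) :
  (forall i, f i t @[t --> F] --> l i) ->
  \sum_i f i t @[t --> F] --> \sum_i l i.
Proof.
move=> fl; apply: (@cvg_big _ _ +%R 0 xpredT) => // -[x y].
exact: add_continuous.
Qed.

Lemma frob_cvg {R : realType} {T : Type} (F : set_system T) {FF : Filter F}
    {p} {u v : T -> 'cV[R]_p} {u0 v0 : 'cV[R]_p} :
  (forall i, u t i 0 @[t --> F] --> u0 i 0) ->
  (forall i, v t i 0 @[t --> F] --> v0 i 0) ->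
  frob (u t) (v t) @[t --> F] --> frob u0 v0.
Proof.
move=> uc vc; rewrite frob_sum.
under eq_cvg do rewrite frob_sum.
by apply: cvg_sumr => i; apply: cvgM.
Qed.

Lemma mulmx_cvg {R : realType} {T : Type} (F : set_system T) {FF : Filter F}
    {p n} (A : T -> 'M[R]_(p, n)) (z : T -> 'cV[R]_n)
    (A0 : 'M[R]_(p, n)) (z0 : 'cV[R]_n) :
  (forall i j, A t i j @[t --> F] --> A0 i j) ->
  (forall j, z t j 0 @[t --> F] --> z0 j 0) ->
  forall i, (A t *m z t) i 0 @[t --> F] --> (A0 *m z0) i 0.
Proof.
move=> Ac zc i; rewrite mxE.
under eq_cvg do rewrite mxE.
by apply: cvg_sumr => j; apply: cvgM.
Qed.

Lemma derive_slope {R : realType} {f : R -> R} {f' : R} :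
  is_derive (0 : R) (1 : R) f f' ->
  (f t - f 0) / t @[t --> (0 : R)^'] --> f'.
Proof.
move=> [fd <-]; have -> : (fun t => (f t - f 0) / t) =
    (fun h => h^-1 *: ((f \o shift 0) (h *: (1 : R)) - f 0)).
  by apply/funext => t /=; rewrite addr0 /GRing.scale /= mulr1 mulrC.
exact: fd.
Qed.

Lemma derive_cvg0 {R : realType} {f : R -> R} {f' : R} :
  is_derive (0 : R) (1 : R) f f' -> f t @[t --> (0 : R)^'] --> f 0.
Proof.
move=> [fd _]; apply: (@cvg_within_filter).
have := differentiable_continuous (proj1 (derivable1_diffP _ _) fd).
exact.
Qed.

Lemma is_derive_bounds {R : realType} (f : R -> R) (f' : R) :
  (forall e, 0 < e -> \forall t \near (0 : R), `|f t - f 0 - t * f'| <= e * `|t|) ->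
  is_derive (0 : R) (1 : R) f f'.
Proof.
move=> H.
suff fd : h^-1 *: ((f \o shift 0) (h *: (1 : R)) - f 0) @[h --> (0:R)^'] --> f'.
  by apply: DeriveDef; [apply: cvgP fd | apply: cvg_lim fd].
apply/cvgrPdist_le => e e0.
have : \forall t \near (0:R)^', `|f t - f 0 - t * f'| <= e * `|t|.
  exact: cvg_within (H e e0).
apply: filter_app; near=> t.
have t0 : t != 0 by near: t; exact: nbhs_dnbhs_neq.
rewrite /= addr0 /GRing.scale /= mulr1 => h.
have -> : f' - t^-1 * (f t - f 0) = - (t^-1 * (f t - f 0 - t * f')).
  by rewrite [t^-1 * (_ - t * f')]mulrBr mulKf // opprB.
by rewrite normrN normrM normfV ler_pdivrMl ?normr_gt0 // [`|t| * e]mulrC.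
Unshelve. all: by end_near. Qed.

Lemma cvg_finer {T : Type} {U : nbhsType} {F G : set_system T} {f : T -> U} {l : U} :
  F --> G -> f t @[t --> G] --> l -> f t @[t --> F] --> l.
Proof. by move=> FG fl; apply: cvg_trans fl; apply: cvg_app. Qed.

Lemma lim_le {R : realType} {F : set_system R}
    {FF : ProperFilter F} {f g : R -> R} {l l' : R} :
  f t @[t --> F] --> l -> g t @[t --> F] --> l' ->
  (\forall t \near F, f t <= g t) -> l <= l'.
Proof. exact: ler_cvg_to. Qed.

Lemma near_eq_lim {R : realType} {F : set_system R}
    {FF : ProperFilter F} {f g : R -> R} {l l' : R} :
  f t @[t --> F] --> l -> g t @[t --> F] --> l' ->
  (\forall t \near F, f t = g t) -> l = l'.
Proof.
move=> fl gl fg; apply: le_anti; apply/andP; split.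
  by apply: (lim_le fl gl); apply: filterS fg => t ->.
by apply: (lim_le gl fl); apply: filterS fg => t ->.
Qed.

Lemma affine_abs_cvg {R : realType} {F : set_system R} {FF : Filter F} (v g e : R) :
  F --> (0 : R)^' -> v + t * g + e * `|t| @[t --> F] --> v.
Proof.
move=> F0.
have tc : t @[t --> F] --> (0 : R).
  by apply: cvg_finer F0 _; apply: cvg_within.
have tg : t * g @[t --> F] --> 0 * g by apply: cvgM => //; exact: cvg_cst.
have te : e * `|t| @[t --> F] --> e * `|0 : R|.
  by apply: cvgM; [exact: cvg_cst|exact: cvg_norm].
have := cvgD (cvgD (cvg_cst v) tg) te.
by rewrite mul0r normr0 mulr0 !addr0; apply.
Qed.

(** * Duality for a fixed program *)

Section FixedProgram.
Context {R : realType} {nr nrb nc : nat}.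
Variables (c : 'cV[R]_nc) (A : 'M[R]_(nr, nc)) (b : 'cV[R]_nr).
Variables (Ab : 'M[R]_(nrb, nc)) (bb : 'cV[R]_nrb).
Variable zs : 'cV[R]_nc.
Hypothesis zsP : primal_solution c A b Ab bb zs.

(** Strong duality: were the dual optimum below the primal one, some r strictly between
would admit a certificate from [lp_alternative], with lam > 0 because zs is
feasible, and dividing by lam would give a dual value of at least r. *)
Lemma dual_solutionP pi pib :
  dual_solution c A b Ab bb pi pib <->
  forall z, nonneg_vec z -> frob c zs <= lagrangian c A b Ab bb z pi pib.
Proof.
have [[zs0 zsA zsB] zsmin] := zsP.
have zsL p q : lagrangian c A b Ab bb zs p q = frob c zs.
  by rewrite /lagrangian zsA zsB !subrr !frobE !mulmx0 !mxE !addr0.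
have weak p q : (dual_function c A b Ab bb p q <= (frob c zs)%:E)%E.
  by apply: ereal_inf_lbound; exists zs => //; rewrite zsL.
split; last first.
  move=> H.
  have dge : ((frob c zs)%:E <= dual_function c A b Ab bb pi pib)%E.
    by apply: le_ereal_inf_tmp => _ [z z0 <-]; rewrite lee_fin H.
  split; first by apply: lt_le_trans dge; exact: ltNyr.
  by move=> p q; apply: le_trans dge.
move=> [_ dmax] z z0; rewrite leNgt; apply/negP => Lz.
pose r := (frob c zs + lagrangian c A b Ab bb z pi pib) / 2.
have [zr rz] : lagrangian c A b Ab bb z pi pib < r /\ r < frob c zs.
  by rewrite /r; split; lra.
have [|lam [p [q [lam0 cone neg]]]] := @lp_alternative _ _ _ _ c A b Ab bb r.
  move=> y yf; apply: (lt_le_trans rz).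
  by have := zsmin y yf; rewrite lee_fin.
have := cone zs zs0; rewrite zsA zsB => cs.
have lamr : lam * (r - frob c zs) < 0.
  by rewrite mulrBr; lra.
have lam_gt0 : 0 < lam.
  rewrite lt_def lam0 andbT; apply/negP => /eqP l0.
  by move: lamr; rewrite l0 mul0r ltxx.
suff : (r%:E <= dual_function c A b Ab bb (lam^-1 *: p) (lam^-1 *: q))%E.
  move=> rdual; have dL : (dual_function c A b Ab bb pi pib
      <= (lagrangian c A b Ab bb z pi pib)%:E)%E.
    by apply: ereal_inf_lbound; exists z.
  have := le_trans rdual (le_trans (dmax _ _) dL).
  by rewrite lee_fin leNgt zr.
apply: le_ereal_inf_tmp => _ [y y0 <-]; rewrite lee_fin /lagrangian !frobBr !frobZl.
have := cone y y0 => cy.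
rewrite -(ler_pM2l lam_gt0) !mulrDr !mulrN !mulVKf ?gt_eqF //.
lra.
Qed.

End FixedProgram.

(** Used with p the reduced costs and q the total weight of a column in the link
rows whose right-hand side is 0: a large multiplier on these rows repairs the
sign of every reduced cost that needs it. *)
Lemma dominating_multiple {R : realFieldType} {I : finType} (p q : I -> R) :
  (forall i, 0 <= q i) -> (forall i, q i = 0 -> 0 <= p i) ->
  exists K, forall i, 0 <= p i + K * q i.
Proof.
move=> q0 pq; exists (\sum_i `|p i| / q i) => i.
have [qi|qi] := eqVneq (q i) 0; first by rewrite qi mulr0 addr0 pq.
have qi0 : 0 < q i by rewrite lt_def qi q0.
have : `|p i| <= (\sum_i `|p i| / q i) * q i.
  rewrite -ler_pdivrMr // (bigD1 i) //= lerDl.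
  by apply: sumr_ge0 => j _; apply: divr_ge0.
by have := ler_norm (- p i); rewrite normrN; lra.
Qed.

(** * Perturbation of a program with unique solutions *)

Section Sensitivity.
Context {R : realType} {nr nrb nc : nat}.
Variables (c : 'cV[R]_nc) (A : R -> 'M[R]_(nr, nc)) (b : R -> 'cV[R]_nr).
Variables (dA : 'M[R]_(nr, nc)) (db : 'cV[R]_nr).
Variables (Ab : 'M[R]_(nrb, nc)) (bb : 'cV[R]_nrb).
Hypothesis A_deriv :
  forall k l, is_derive (0 : R) (1 : R) (fun t => A t k l) (dA k l).
Hypothesis b_deriv :
  forall k, is_derive (0 : R) (1 : R) (fun t => b t k 0) (db k 0).

Local Notation feasible t := (std_feasible (A t) (b t) Ab bb).

Lemma limit_feasible (bc : 'cV[R]_nrb) (F : set_system R) {FF : ProperFilter F}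
    (z : R -> 'cV[R]_nc) (z0 : 'cV[R]_nc) :
  F --> (0 : R)^' -> (\forall t \near F, std_feasible (A t) (b t) Ab bc (z t)) ->
  (forall l, z t l 0 @[t --> F] --> z0 l 0) -> std_feasible (A 0) (b 0) Ab bc z0.
Proof.
move=> F0 zf zz0; split.
- move=> l; apply: (lim_le (cvg_cst 0) (zz0 l)).
  by apply: filterS zf => t [].
- apply/colP => k.
  have AzF : (A t *m z t) k 0 @[t --> F] --> (A 0 *m z0) k 0.
    apply: mulmx_cvg => // i j.
    exact: cvg_finer F0 (derive_cvg0 (A_deriv i j)).
  have bF : b t k 0 @[t --> F] --> b 0 k 0.
    exact: cvg_finer F0 (derive_cvg0 (b_deriv k)).
  by apply: (near_eq_lim AzF bF); apply: filterS zf => t [_ -> _].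
- apply/colP => k.
  have BzF : (Ab *m z t) k 0 @[t --> F] --> (Ab *m z0) k 0.
    by apply: mulmx_cvg => // i j; exact: cvg_cst.
  apply: (near_eq_lim BzF (cvg_cst (bc k 0))).
  by apply: filterS zf => t [_ _ ->].
Qed.

(** The bound is uniform in t but may depend on the coordinate, and the link
right-hand side bc is free since it varies with Y. *)
Definition bounded_feasible (bc : 'cV[R]_nrb) :=
  forall l, exists K : R, \forall t \near (0 : R),
    forall z, std_feasible (A t) (b t) Ab bc z -> z l 0 <= K.

Lemma ultra_limit_feasible (bc : 'cV[R]_nrb) (F : set_system R) (z : R -> 'cV[R]_nc) :
  bounded_feasible bc -> UltraFilter F -> F --> (0 : R)^' ->
  (\forall t \near F, std_feasible (A t) (b t) Ab bc (z t)) ->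
  exists2 z0, std_feasible (A 0) (b 0) Ab bc z0 &
    forall l, z t l 0 @[t --> F] --> z0 l 0.
Proof.
move=> bnd FU F0 zf.
have lim l : exists x : R, z t l 0 @[t --> F] --> x.
  have [K HK] := bnd l.
  apply: (ultra_bounded_cvg F (fun t => z t l 0) K).
  have : \forall t \near F, forall z, std_feasible (A t) (b t) Ab bc z -> z l 0 <= K.
    exact/F0/nbhs_dnbhs.
  by move: zf; apply: filterS2 => t zf HKt; rewrite ger0_norm ?HKt //; case: zf => ->.
have [x xP] := choice lim.
exists (\col_l x l); last by move=> l; rewrite mxE.
by apply: limit_feasible F0 zf _ => l; rewrite mxE.
Qed.

(** Lower semicontinuity of the value at t = 0: feasible points of cost at most r
at parameters tending to 0 would have a feasible limit of cost at most r. *)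
Lemma infeasible_near (bc : 'cV[R]_nrb) (r : R) :
  bounded_feasible bc ->
  (forall z, std_feasible (A 0) (b 0) Ab bc z -> r < frob c z) ->
  \forall t \near (0 : R), forall z, std_feasible (A t) (b t) Ab bc z -> r < frob c z.
Proof.
move=> bnd r0; apply: near0_ultra => // F FU F0 bad.
have wit t : exists z : 'cV[R]_nc,
    ~ (forall z, std_feasible (A t) (b t) Ab bc z -> r < frob c z) ->
    std_feasible (A t) (b t) Ab bc z /\ frob c z <= r.
  have [h|] := pselect (forall z, std_feasible (A t) (b t) Ab bc z -> r < frob c z).
    by exists 0.
  move=> /existsNP[z /not_implyP[zf /negP]]; rewrite -leNgt => zr.
  by exists z.
have [z zP] := choice wit.
have [|z0 z0f zz0] := @ultra_limit_feasible bc F z bnd FU F0.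
  by apply: filterS bad => t /zP[].
have : frob c z0 <= r.
  have cz : frob c (z t) @[t --> F] --> frob c z0.
    by apply: frob_cvg => // i; exact: cvg_cst.
  apply: (lim_le cz (cvg_cst r)).
  by apply: filterS bad => t /zP[].
by rewrite leNgt r0.
Qed.

Hypothesis Ab_ge0 : forall k l, 0 <= Ab k l.
Hypothesis bb_ge0 : forall k, 0 <= bb k 0.
Hypothesis slack : forall k, exists l, [/\ c l 0 = 0, forall i, A 0 i l = 0
  & forall k', Ab k' l = (k' == k)%:R].
Variables (zs : 'cV[R]_nc) (pis : 'cV[R]_nr).
Hypothesis zsP : unique_primal_solution c (A 0) (b 0) Ab bb zs.
Hypothesis pisP : unique_dual_solution c (A 0) (b 0) Ab bb pis.

Let v0 := frob c zs.
Let g := frob pis (dA *m zs - db).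

(** On these vectors the multipliers of the link rows with right-hand side 0 have
no effect; every feasible point is of this kind. *)
Definition live : set 'cV[R]_nc :=
  [set z | nonneg_vec z /\ forall k, bb k 0 = 0 -> (Ab *m z) k 0 = 0].

(** A large multiplier on the link rows with right-hand side 0 extends the
certificate from [live] to all z >= 0. Adding it to a dual solution and dividing
by 1 + lam gives another dual solution, so (pis + pi) / (1 + lam) = pis. If
lam = 0, then pi = 0; the slack columns give pib >= 0, and the inequality
pib bb <= 0 leaves only pib = 0. *)
Lemma certificate_is_multiple (lam : R) (pi : 'cV[R]_nr) (pib : 'cV[R]_nrb) :
  0 <= lam -> (forall k, bb k 0 = 0 -> pib k 0 = 0) ->
  (forall z, live z ->
     0 <= lam * frob c z + frob pi (A 0 *m z) + frob pib (Ab *m z)) ->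
  lam * v0 + frob pi (b 0) + frob pib bb <= 0 ->
  pi = lam *: pis /\ (lam = 0 -> pib = 0).
Proof.
move=> lam0 pibd cone val.
pose phi z := lam * frob c z + frob pi (A 0 *m z) + frob pib (Ab *m z).
(* dead is the indicator of the link rows with right-hand side 0. *)
pose dead : 'cV[R]_nrb := \col_k (bb k 0 == 0)%:R.
have dead0 (u : 'cV[R]_nrb) : frob dead u = \sum_(k | bb k 0 == 0) u k 0.
  rewrite frob_sum [RHS]big_mkcond /=; apply: eq_bigr => k _; rewrite mxE.
  by case: eqP; rewrite ?mul1r ?mul0r.
have e_ge0 l : nonneg_vec (delta_mx l 0 : 'cV[R]_nc).
  by move=> i; rewrite mxE ler0n.
have Abe k l : (Ab *m delta_mx l 0 : 'cV[R]_nrb) k 0 = Ab k l.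
  by rewrite -colE mxE.
have [l|l dl|K Kpos] := dominating_multiple (fun l => phi (delta_mx l 0))
    (fun l => frob dead (Ab *m delta_mx l 0)).
- by rewrite dead0; apply: sumr_ge0 => k _; rewrite Abe.
- apply: cone; split => // k bk.
  move: dl; rewrite dead0 => /eqP; rewrite psumr_eq0 => [|k' _]; last by rewrite Abe.
  by move=> /allP/(_ k); rewrite mem_index_enum bk eqxx => /(_ isT) /eqP.
pose pib' := pib + K *: dead.
have cone' z : nonneg_vec z ->
    0 <= lam * frob c z + frob pi (A 0 *m z) + frob pib' (Ab *m z).
  move=> z0.
  have -> : lam * frob c z + frob pi (A 0 *m z) + frob pib' (Ab *m z) =
     \sum_l z l 0 * (phi (delta_mx l 0) + K * frob dead (Ab *m delta_mx l 0)).
    pose f (z : 'cV[R]_nc) := lam * frob c z + frob pi (A 0 *m z) + frob pib' (Ab *m z).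
    have fD u v : f (u + v) = f u + f v.
      by rewrite /f !mulmxDr !frobDr mulrDr; lra.
    have fZ a u : f (a *: u) = a * f u.
      by rewrite /f -!scalemxAr !frobZr; lra.
    have f0 : f 0 = 0 by rewrite -(scale0r 0) fZ mul0r.
    transitivity (f (\sum_l z l 0 *: delta_mx l 0)).
      congr (f _); rewrite {1}(matrix_sum_delta z); apply: eq_bigr => l _.
      by rewrite big_ord1.
    rewrite (big_morph f fD f0); apply: eq_bigr => l _; rewrite fZ; congr (_ * _).
    by rewrite /f /phi /pib' frobDl frobZl addrA.
  by apply: sumr_ge0 => l _; apply: mulr_ge0.
have bbdead : frob dead bb = 0.
  by rewrite dead0 big1 // => k /eqP.
have [[pib0 pib0P] uniq] := pisP.
have opt := (dual_solutionP _ _ _ _ _ _ (proj1 zsP) _ _).1 pib0P.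
have lam1 : 0 < 1 + lam by rewrite ltr_pwDl.
have pisE : (1 + lam)^-1 *: (pis + pi) = pis.
  apply: (uniq _ ((1 + lam)^-1 *: (pib0 + pib'))).
  apply/(dual_solutionP _ _ _ _ _ _ (proj1 zsP)) => z z0.
  rewrite -(ler_pM2l lam1) /lagrangian !frobZl !mulrDr !mulVKf ?gt_eqF //.
  have := cone' z z0; have := opt z z0; move: val.
  rewrite /lagrangian /v0 /pib' !frobBr !frobDl !frobZl bbdead; nra.
have piE : pi = lam *: pis.
  have : pis + pi = (1 + lam) *: pis by rewrite -{2}pisE scalerA mulfV ?gt_eqF // scale1r.
  by rewrite scalerDl scale1r => /addrI.
split=> // l0; move: val; rewrite piE l0 scale0r mul0r add0r {1}frobE linear0 mul0mx mxE add0r.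
have pib_ge0 k : 0 <= pib k 0.
  have [/pibd -> //|bk] := eqVneq (bb k 0) 0.
  have [l [cl Al Abl]] := slack k.
  have : live (delta_mx l 0).
    split=> // k' bk'; rewrite Abe Abl; case: eqP => // kk'.
    by move: bk; rewrite -kk' bk' eqxx.
  move/cone; rewrite l0 mul0r add0r piE l0 scale0r {1}frobE linear0 mul0mx mxE add0r.
  rewrite frob_sum (bigD1 k) //= Abe Abl eqxx mulr1 big1 ?addr0 // => k' kk'.
  by rewrite Abe Abl (negPf kk') mulr0.
rewrite frob_sum => val; apply/colP => k; rewrite mxE.
have [/pibd //|bk] := eqVneq (bb k 0) 0.
have : \sum_i pib i 0 * bb i 0 == 0.
  by rewrite eq_le val sumr_ge0 // => i _; apply: mulr_ge0.
rewrite psumr_eq0 => [/allP/(_ k)|i _]; last exact: mulr_ge0.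
by rewrite mem_index_enum mulf_eq0 (negPf bk) orbF => /(_ isT)/eqP.
Qed.

Let slopeA t := t^-1 *: (A t - A 0).
Let slopeb t := t^-1 *: (b t - b 0).

Lemma slope_cvg (F : set_system R) {FF : Filter F} (pi : R -> 'cV[R]_nr)
    (z : R -> 'cV[R]_nc) (pi0 : 'cV[R]_nr) (z0 : 'cV[R]_nc) :
  F --> (0 : R)^' ->
  (forall k, pi t k 0 @[t --> F] --> pi0 k 0) ->
  (forall l, z t l 0 @[t --> F] --> z0 l 0) ->
  frob (pi t) (slopeA t *m z t - slopeb t) @[t --> F] --> frob pi0 (dA *m z0 - db).
Proof.
move=> F0 pic zc; apply: frob_cvg => // k.
rewrite [(dA *m z0 - db) k 0]mxE [(- db) k 0]mxE.
have -> : (fun t => (slopeA t *m z t - slopeb t) k 0)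
    = (fun t => (slopeA t *m z t) k 0 - slopeb t k 0).
  by apply/funext => t; rewrite mxE [(- slopeb t) k 0]mxE.
apply: cvgB.
  apply: mulmx_cvg => // i j; rewrite /slopeA.
  under eq_cvg do rewrite 3!mxE mulrC.
  exact: cvg_finer F0 (derive_slope (A_deriv i j)).
rewrite /slopeb; under eq_cvg do rewrite 3!mxE mulrC.
exact: cvg_finer F0 (derive_slope (b_deriv k)).
Qed.

Lemma slopeE t z : t != 0 ->
  t *: (slopeA t *m z - slopeb t) = (A t *m z - b t) - (A 0 *m z - b 0).
Proof.
move=> t0; rewrite scalerBr scalemxAl !scalerA mulfV // !scale1r mulmxBl.
move: (A t *m z) (A 0 *m z) => u v.
by apply/colP => i; rewrite !mxE; ring.
Qed.

(** The normalization keeps the multipliers in a compact set and their limits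
nonzero. *)
Definition certificate (t r : R) (w : R * 'cV[R]_nr * 'cV[R]_nrb) : Prop :=
  [/\ 0 <= w.1.1,
      w.1.1 + \sum_k `|w.1.2 k 0| + \sum_k `|w.2 k 0| = 1,
      forall k, bb k 0 = 0 -> w.2 k 0 = 0,
      forall z, live z ->
        0 <= w.1.1 * frob c z + frob w.1.2 (A t *m z) + frob w.2 (Ab *m z)
    & w.1.1 * r + frob w.1.2 (b t) + frob w.2 bb < 0].

Lemma certificate_exists t r :
  (forall z, feasible t z -> r < frob c z) -> exists w, certificate t r w.
Proof.
move=> /lp_alternative [lam [pi [pib [lam0 cone neg]]]].
pose pib' : 'cV[R]_nrb := \col_k if bb k 0 == 0 then 0 else pib k 0.
have pib'E (u : 'cV[R]_nrb) : (forall k, bb k 0 = 0 -> u k 0 = 0) ->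
    frob pib' u = frob pib u.
  move=> u0; rewrite !frob_sum; apply: eq_bigr => k _; rewrite mxE.
  by case: eqP => // /u0 ->; rewrite !mulr0.
pose N := lam + \sum_k `|pi k 0| + \sum_k `|pib' k 0|.
have N0 : 0 <= N by rewrite !addr_ge0 ?sumr_ge0.
have N_gt0 : 0 < N.
  rewrite lt_def N0 andbT; apply/eqP => NE; move: neg.
  have sp0 : 0 <= \sum_k `|pi k 0| by rewrite sumr_ge0.
  have sq0 : 0 <= \sum_k `|pib' k 0| by rewrite sumr_ge0.
  have lamE : lam = 0 by move: NE; rewrite /N; lra.
  have /eqP : \sum_k `|pi k 0| = 0 by move: NE; rewrite /N; lra.
  have /eqP : \sum_k `|pib' k 0| = 0 by move: NE; rewrite /N; lra.
  rewrite !psumr_eq0 => [/allP q0 /allP p0||]; [|by []..].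
  have pi0 : pi = 0.
    apply/colP => k; have := p0 k; rewrite mem_index_enum normr_eq0 mxE.
    by move=> /(_ isT)/eqP.
  have pib0 : pib' = 0.
    apply/colP => k; have := q0 k; rewrite mem_index_enum normr_eq0 => /(_ isT)/eqP ->.
    by rewrite mxE.
  rewrite -pib'E // pib0 pi0 lamE mul0r !frobE !linear0 !mul0mx !mxE !addr0.
  by rewrite ltxx.
exists (N^-1 * lam, N^-1 *: pi, N^-1 *: pib'); split => /=.
- by rewrite mulr_ge0 // invr_ge0.
- have e (n : nat) (u : 'cV[R]_n) : \sum_k `|(N^-1 *: u) k 0| = N^-1 * \sum_k `|u k 0|.
    rewrite mulr_sumr; apply: eq_bigr => k _.
    by rewrite mxE normrM ger0_norm // invr_ge0.
  by rewrite !e -!mulrDr mulVf // gt_eqF.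
- by move=> k bk; rewrite !mxE bk eqxx mulr0.
- move=> z [z0 zl]; rewrite !frobZl pib'E // -mulrA -!mulrDr.
  by rewrite mulr_ge0 ?invr_ge0 ?cone.
- by rewrite !frobZl pib'E // -mulrA -!mulrDr nmulr_llt0 // invr_gt0.
Qed.

(** Otherwise there are certificates at parameters tending to 0. Their limit is a
positive multiple of the dual solution, and comparing a certificate at t with
the feasibility of zs at 0 gives
lam (t g + e|t|) < pi ((A(t) - A(0)) zs - (b(t) - b(0))), where after
division by |t| both sides are within o(1) of lam times the slope g. *)
Lemma feasible_upper e : 0 < e -> \forall t \near (0 : R),
  exists2 z, feasible t z & frob c z <= v0 + t * g + e * `|t|.
Proof.
move=> e0; have [zs0 zsA zsB] := (proj1 (proj1 zsP)).
apply: near0_ultra.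
  by exists zs => //; rewrite mul0r normr0 mulr0 !addr0.
move=> F FU F0 bad.
have F_neq0 : \forall t \near F, t != 0 by apply: F0; exact: (nbhs_dnbhs_neq (0 : R)).
have wit t : exists w,
    ~ (exists2 z, feasible t z & frob c z <= v0 + t * g + e * `|t|) ->
    certificate t (v0 + t * g + e * `|t|) w.
  have [h|h] := pselect (exists2 z, feasible t z & frob c z <= v0 + t * g + e * `|t|).
    by exists (0, 0, 0).
  have [|w wP] := certificate_exists t (v0 + t * g + e * `|t|).
    by move=> z zf; rewrite ltNge; apply/negP => zr; apply: h; exists z.
  by exists w.
have [w wP] := choice wit => {wit}.
have {}wP : \forall t \near F, certificate t (v0 + t * g + e * `|t|) (w t).
  by apply: filterS bad => t; apply: wP.
have [lam lamc] : exists l : R, (w t).1.1 @[t --> F] --> l.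
  apply: (ultra_bounded_cvg F (fun t => (w t).1.1) 1).
  apply: filterS wP => t [l0 <- _ _ _]; rewrite ger0_norm // -addrA lerDl.
  by rewrite addr_ge0 ?sumr_ge0.
have /choice[p pc] k : exists l : R, (w t).1.2 k 0 @[t --> F] --> l.
  apply: (ultra_bounded_cvg F (fun t => (w t).1.2 k 0) 1).
  apply: filterS wP => t [l0 <- _ _ _]; rewrite (bigD1 k) //= -!addrA addrCA lerDl.
  by rewrite !addr_ge0 ?sumr_ge0.
have /choice[q qc] k : exists l : R, (w t).2 k 0 @[t --> F] --> l.
  apply: (ultra_bounded_cvg F (fun t => (w t).2 k 0) 1).
  apply: filterS wP => t [l0 <- _ _ _]; rewrite [X in _ + X](bigD1 k) //= addrCA lerDl.
  by rewrite !addr_ge0 ?sumr_ge0.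
pose pi : 'cV[R]_nr := \col_k p k; pose pib : 'cV[R]_nrb := \col_k q k.
have {}pc k : (w t).1.2 k 0 @[t --> F] --> pi k 0 by rewrite mxE.
have {}qc k : (w t).2 k 0 @[t --> F] --> pib k 0 by rewrite mxE.
have Ac i j : A t i j @[t --> F] --> A 0 i j.
  exact: cvg_finer F0 (derive_cvg0 (A_deriv i j)).
have bc i : b t i 0 @[t --> F] --> b 0 i 0.
  exact: cvg_finer F0 (derive_cvg0 (b_deriv i)).
have [||||piE pibE] := certificate_is_multiple lam pi pib.
- by apply: (lim_le (cvg_cst 0) lamc); apply: filterS wP => t [].
- move=> k bk; apply: (near_eq_lim (qc k) (cvg_cst 0)).
  by apply: filterS wP => t [_ _ /(_ k bk)].
- move=> z zl.
  have h : (w t).1.1 * frob c z + frob (w t).1.2 (A t *m z) + frob (w t).2 (Ab *m z)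
      @[t --> F] --> lam * frob c z + frob pi (A 0 *m z) + frob pib (Ab *m z).
    apply: cvgD; first apply: cvgD; first apply: cvgM => //.
    - exact: cvg_cst.
    - by apply: frob_cvg => //; apply: mulmx_cvg => // i; exact: cvg_cst.
    by apply: frob_cvg => // i; exact: cvg_cst.
  by apply: (lim_le (cvg_cst 0) h); apply: filterS wP => t [_ _ _ /(_ z zl)].
- have hb : frob (w t).1.2 (b t) @[t --> F] --> frob pi (b 0) by exact: frob_cvg.
  have hbb : frob (w t).2 bb @[t --> F] --> frob pib bb.
    by apply: frob_cvg => // i; exact: cvg_cst.
  have h : (w t).1.1 * (v0 + t * g + e * `|t|) + frob (w t).1.2 (b t) + frob (w t).2 bb
      @[t --> F] --> lam * v0 + frob pi (b 0) + frob pib bb.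
    exact: (cvgD (cvgD (cvgM lamc (affine_abs_cvg v0 g e F0)) hb) hbb).
  by apply: (lim_le h (cvg_cst 0)); apply: filterS wP => t [_ _ _ _ /ltW].
(* If lam = 0, the whole limit multiplier is 0, against its norm being 1. *)
have lam_gt0 : 0 < lam.
  have lam0 : 0 <= lam by apply: (lim_le (cvg_cst 0) lamc); apply: filterS wP => t [].
  rewrite lt_def lam0 andbT; apply/eqP => lamE.
  have h : (w t).1.1 + \sum_k `|(w t).1.2 k 0| + \sum_k `|(w t).2 k 0|
      @[t --> F] --> lam + \sum_k `|pi k 0| + \sum_k `|pib k 0|.
    by apply: cvgD; first apply: cvgD => //; apply: cvg_sumr => k; apply: cvg_norm.
  have : lam + \sum_k `|pi k 0| + \sum_k `|pib k 0| = 1.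
    have h1 := near_eq_lim h (cvg_cst (1 : R)).
    by apply: h1; apply: filterS wP => t [].
  rewrite piE (pibE lamE) lamE !big1 => [|k _|k _]; last first.
  - by rewrite mxE mul0r normr0.
  - by rewrite mxE normr0.
  by rewrite !addr0 => /eqP; rewrite eq_sym oner_eq0.
have qcv : frob (w t).1.2 (slopeA t *m zs - slopeb t) @[t --> F]
    --> frob pi (dA *m zs - db).
  by apply: (slope_cvg F _ (fun=> zs)) => // l; exact: cvg_cst.
have hl : (w t).1.1 * e @[t --> F] --> lam * e.
  by apply: cvgM => //; exact: cvg_cst.
have hr : `|frob (w t).1.2 (slopeA t *m zs - slopeb t) - (w t).1.1 * g|
    @[t --> F] --> `|frob pi (dA *m zs - db) - lam * g|.
  have hg : (w t).1.1 * g @[t --> F] --> lam * g by apply: cvgM => //; exact: cvg_cst.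
  exact: (cvg_norm (cvgB qcv hg)).
(* The sign of t is unknown, so the quotients are compared in absolute value. *)
have : lam * e <= `|frob pi (dA *m zs - db) - lam * g|.
  apply: (lim_le hl hr); apply: filterS2 wP F_neq0 => t [l0 _ _ cone neg] t0.
  have {}cone : 0 <= (w t).1.1 * v0 + frob (w t).1.2 (A t *m zs) + frob (w t).2 bb.
    by rewrite -zsB; apply: cone; split => // k; rewrite zsB.
  have tq : t * frob (w t).1.2 (slopeA t *m zs - slopeb t)
      = frob (w t).1.2 (A t *m zs) - frob (w t).1.2 (b t).
    rewrite -frobZr slopeE //.
    by rewrite zsA subrr subr0 frobBr.
  rewrite -(ler_pM2l (_ : 0 < `|t|)) ?normr_gt0 // -normrM mulrBr tq.
  by apply: le_trans (ler_norm _); move: neg cone; nra.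
by rewrite piE frobZl -/g subrr normr0 leNgt mulr_gt0.
Qed.

(** Cheap feasible points at parameters tending to 0 converge to zs by uniqueness,
and weak duality with a dual solution at t = 0 bounds their cost from below by
v0 + pis ((A(t) - A(0)) z - (b(t) - b(0))). *)
Lemma feasible_lower e : bounded_feasible bb -> 0 < e -> \forall t \near (0 : R),
  forall z, feasible t z -> v0 + t * g - e * `|t| <= frob c z.
Proof.
move=> bnd e0; have [[[zs0 zsA zsB] zsmin] zsuniq] := zsP.
apply: near0_ultra.
  by move=> z /zsmin; rewrite lee_fin mul0r normr0 mulr0 subr0 addr0.
move=> F FU F0 bad.
have F_neq0 : \forall t \near F, t != 0 by apply: F0; exact: (nbhs_dnbhs_neq (0 : R)).
have wit t : exists z : 'cV[R]_nc,
    ~ (forall z, feasible t z -> v0 + t * g - e * `|t| <= frob c z) ->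
    feasible t z /\ frob c z < v0 + t * g - e * `|t|.
  have [h|] := pselect (forall z, feasible t z -> v0 + t * g - e * `|t| <= frob c z).
    by exists 0.
  move=> /existsNP[z /not_implyP[zf /negP]]; rewrite -ltNge => zr.
  by exists z.
have [z zP] := choice wit => {wit}.
have {}zP : \forall t \near F, feasible t (z t) /\ frob c (z t) < v0 + t * g - e * `|t|.
  by apply: filterS bad => t; apply: zP.
have [|z0 z0f zc] := ultra_limit_feasible bb F z bnd FU F0.
  by apply: filterS zP => t [].
have z0E : z0 = zs.
  apply: zsuniq; split => // y /zsmin; rewrite !lee_fin; apply: le_trans.
  have hl : frob c (z t) @[t --> F] --> frob c z0.
    by apply: frob_cvg => // i; exact: cvg_cst.
  have hr : v0 + t * g + - e * `|t| @[t --> F] --> v0 by exact: affine_abs_cvg.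
  apply: (lim_le hl hr); apply: filterS zP => t [_ /ltW].
  by rewrite mulNr.
have [[pib0 pib0P] _] := pisP.
have opt := (dual_solutionP _ _ _ _ _ _ (proj1 zsP) _ _).1 pib0P.
have hr : `|frob pis (slopeA t *m z t - slopeb t) - g| @[t --> F] --> `|g - g|.
  have qcv : frob pis (slopeA t *m z t - slopeb t) @[t --> F] --> g.
    by apply: (slope_cvg F (fun=> pis)) => // l; [exact: cvg_cst|rewrite -z0E].
  exact: (cvg_norm (cvgB qcv (cvg_cst g))).
have : e <= `|g - g|.
  apply: (lim_le (cvg_cst e) hr); apply: filterS2 zP F_neq0 => t [[zt0 ztA ztB] zlt] t0.
  have := opt _ zt0; rewrite /lagrangian ztB subrr [frob pib0 0]frobE mulmx0 mxE addr0.
  have tq : t * frob pis (slopeA t *m z t - slopeb t)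
      = - frob pis (A 0 *m z t - b 0).
    rewrite -frobZr slopeE //.
    by rewrite ztA subrr sub0r frobE mulmxN mxE -frobE.
  move=> hopt.
  rewrite -(ler_pM2l (_ : 0 < `|t|)) ?normr_gt0 // -normrM mulrBr tq -[X in _ <= X]normrN.
  by apply: le_trans (ler_norm _); move: hopt; rewrite -/v0; lra.
by rewrite subrr normr0 leNgt e0.
Qed.

End Sensitivity.

(** * Linear functionals of the LP variables *)

Section Linear.
Context {R : realType} {T : Type}.
Implicit Types (f g : (T -> R) -> R).

(** Linearity is spelled out pointwise because the rows of the program are plain
functions of the values z : lp_col -> R. *)
Definition linfn f := forall a u v, f (fun c => a * u c + v c) = a * f u + f v.

Lemma linfn_coord c : linfn (fun z => z c).
Proof. by []. Qed.

Lemma linfnD f g : linfn f -> linfn g -> linfn (fun z => f z + g z).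
Proof. by move=> hf hg a u v; rewrite hf hg mulrDr addrACA. Qed.

Lemma linfnB f g : linfn f -> linfn g -> linfn (fun z => f z - g z).
Proof. by move=> hf hg a u v; rewrite hf hg mulrBr opprD addrACA. Qed.

Lemma linfnMr f k : linfn f -> linfn (fun z => f z * k).
Proof. by move=> hf a u v; rewrite hf mulrDl mulrA. Qed.

Lemma linfnMl f k : linfn f -> linfn (fun z => k * f z).
Proof. by move=> hf a u v; rewrite hf mulrDr mulrCA. Qed.

Lemma linfn_sum {I : finType} (F : I -> (T -> R) -> R) :
  (forall i, linfn (F i)) -> linfn (fun z => \sum_i F i z).
Proof.
move=> hF a u v; rewrite mulr_sumr -big_split /=.
by apply: eq_bigr => i _; apply: hF.
Qed.

Lemma linfn0 f : linfn f -> f (fun=> 0) = 0.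
Proof.
move=> /(_ (-1) (fun=> 0) (fun=> 0)).
have -> : (fun _ : T => -1 * 0 + 0 : R) = fun=> 0 by apply/funext => c; rewrite mulr0 addr0.
by rewrite mulN1r addNr.
Qed.

Lemma linfn_bigsum f {I : Type} (r : seq I) (a : I -> R) (u : I -> T -> R) :
  linfn f -> f (fun c => \sum_(i <- r) a i * u i c) = \sum_(i <- r) a i * f (u i).
Proof.
move=> hf; elim: r => [|i r IH].
  rewrite big_nil -[RHS](linfn0 f hf); congr f; apply/funext => c.
  by rewrite big_nil.
rewrite big_cons -IH -hf; congr f; apply/funext => c.
by rewrite big_cons.
Qed.

End Linear.

Lemma linfn_expand {R : realType} {T : finType} (f : (T -> R) -> R) (u : T -> R) :
  linfn f -> f u = \sum_c f (fun c' => (c' == c)%:R) * u c.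
Proof.
move=> hf; under eq_bigr do rewrite mulrC.
rewrite -linfn_bigsum //; congr f; apply/funext => c.
rewrite (bigD1 c) //= big1 ?addr0 => [|c' cc']; first by rewrite eqxx mulr1.
by rewrite eq_sym (negPf cc') mulr0.
Qed.

(** * The standard form in terms of its rows *)

Section Bridge.
Context {R : realType} {m nc nl d : nat}.
Variables (D : qcqp R m nc nl) (beta : 'I_nc -> seq R).
Local Notation vr := (@lshift nc nl).
Local Notation col := (lp_col D d beta).
Implicit Types (P : 'M[R]_(nc, d.+2)) (Y : 'M[bool]_(nc, d.+1)) (u : col -> R).

Definition colfun (z : 'cV[R]_#|{: col}|) : col -> R := fun c => z (enum_rank c) 0.

Lemma linfn_matrix f (z : 'cV[R]_#|{: col}|) : linfn f ->
  \sum_l f (unit_col l) * z l 0 = f (colfun z).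
Proof.
move=> hf; rewrite (linfn_expand f (colfun z) hf) [RHS](reindex (@enum_val _ xpredT)) /=.
  by apply: eq_bigr => l _; rewrite /colfun enum_valK.
by apply: onW_bij; exact: enum_val_bij.
Qed.

Lemma WmatE u i j : Wmat u i j =
  \sum_(e : bilI D) u (ColWb d beta e) *
    (((i == vr (val e).1) && (j == vr (val e).2))%:R
     + ((i == vr (val e).2) && (j == vr (val e).1))%:R)
  + \sum_(k : sqI D) u (ColWs d beta k) * ((i == vr (val k)) && (j == vr (val k)))%:R.
Proof.
rewrite /Wmat mxE !summxE; congr (_ + _).
  by apply: eq_bigr => e _; rewrite !mxE.
by apply: eq_bigr => k _; rewrite !mxE.
Qed.

Lemma linfn_form s : linfn (fun u : col -> R => Defs.form D s (xvec u) (Wmat u)).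
Proof.
rewrite /Defs.form /frob; apply: linfnD.
  apply: linfn_sum => i; apply: linfn_sum => j; apply: linfnMl.
  by move=> a u v; rewrite !mxE.
apply: linfn_sum => i; apply: linfn_sum => j; apply: linfnMl.
move=> a u v; rewrite !WmatE; move: a u v; apply: linfnD;
  by apply: linfn_sum => e; apply: linfnMr; apply: linfn_coord.
Qed.

Lemma linfn_row P r : linfn (fun u : col -> R => row_lhs P u r).
Proof.
case: r => [[e|e|e|e|k|k]|[i|i|k|k j]] /=;
  rewrite /row_lhs /eq_lhs /ineq_lhs;
  repeat first [exact: linfn_coord | exact: linfn_form | apply: linfn_sum => ?
    | apply: linfnMr | apply: linfnB | apply: linfnD | apply: linfnMl].
Qed.

Lemma linfn_link r : linfn (fun u : col -> R => link_lhs u r + u (ColLinkSlack beta r)).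
Proof.
apply: linfnD; last exact: linfn_coord.
case: r => [e l|e l|k l]; rewrite /link_lhs;
  by repeat first [exact: linfn_coord | apply: linfn_sum => ?].
Qed.

Lemma costcE (z : 'cV[R]_#|{: col}|) :
  frob (costc D d beta) z = Defs.form D ord0 (xvec (colfun z)) (Wmat (colfun z)).
Proof.
rewrite frob_sum -[RHS](linfn_matrix (fun u => Defs.form D ord0 (xvec u) (Wmat u)) z);
  last exact: linfn_form.
by apply: eq_bigr => l _; rewrite mxE.
Qed.

Lemma matME P (z : 'cV[R]_#|{: col}|) k :
  (matM D beta P *m z) k 0 = row_lhs P (colfun z) (enum_val k).
Proof.
rewrite mxE -[RHS](linfn_matrix (fun u => row_lhs P u (enum_val k)) z);
  last exact: linfn_row.
by apply: eq_bigr => l _; rewrite mxE.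
Qed.

Lemma matMbarE (z : 'cV[R]_#|{: col}|) k :
  (matMbar D d beta *m z) k 0 =
  link_lhs (colfun z) (enum_val k) + colfun z (ColLinkSlack beta (enum_val k)).
Proof.
rewrite mxE -[RHS](linfn_matrix (fun u =>
  link_lhs u (enum_val k) + u (ColLinkSlack beta (enum_val k)))); last exact: linfn_link.
by apply: eq_bigr => l _; rewrite mxE.
Qed.

Lemma link_rhs_linear r a (Y1 Y2 : 'M[R]_(nc, d.+1)) :
  link_rhs (D:=D) (a *: Y1 + Y2) r = a * link_rhs Y1 r + link_rhs Y2 r.
Proof.
have adj (i : 'I_nc) (l : 'I_d.+2) :
    adjY (a *: Y1 + Y2) i l = a * adjY Y1 i l + adjY Y2 i l.
  rewrite /adjY mulr_sumr -big_split /=; apply: eq_bigr => t _.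
  by rewrite !mxE.
by case: r => * /=; rewrite adj.
Qed.

Lemma matBbarE Y k :
  (matBbar D d *m vecY Y) k 0 = link_rhs (realY Y) (enum_val k).
Proof.
pose y : 'rV[R]_(nc * d.+1) := mxvec (realY Y).
have -> : realY Y = vec_mx y by rewrite mxvecK.
rewrite mxE [in RHS](row_sum_delta y) linear_sum /=.
have h (r : seq 'I_(nc * d.+1)) :
   link_rhs (\sum_(t <- r) vec_mx (y 0 t *: delta_mx 0 t)) (enum_val k)
   = \sum_(t <- r) y 0 t * link_rhs (D:=D) (vec_mx (delta_mx 0 t)) (enum_val k).
  elim: r => [|t r IH].
    have := link_rhs_linear (enum_val k) (-1) 0 0.
    by rewrite !big_nil scaler0 addr0 mulN1r addNr.
  by rewrite !big_cons linearZ /= link_rhs_linear IH.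
by rewrite h; apply: eq_bigr => t _; rewrite !mxE mulrC.
Qed.

Definition lp_sol P Y u : Prop :=
  [/\ forall c, 0 <= u c, forall r, row_lhs P u r = row_rhs P r
    & forall r, link_lhs u r + u (ColLinkSlack beta r) = link_rhs (realY Y) r].

Lemma std_feasibleE P Y z :
  std_feasible (matM D beta P) (vecd D beta P) (matMbar D d beta)
    (matBbar D d *m vecY Y) z <-> lp_sol P Y (colfun z).
Proof.
split=> [[z0 zA zB]|[z0 zA zB]]; split.
- by move=> c; apply: z0.
- move=> r; have := congr1 (fun v : 'cV[R]__ => v (enum_rank r) 0) zA.
  by rewrite /= matME mxE enum_rankK.
- move=> r; have := congr1 (fun v : 'cV[R]__ => v (enum_rank r) 0) zB.
  by rewrite /= matMbarE matBbarE enum_rankK.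
- by move=> l; have := z0 (enum_val l); rewrite /colfun enum_valK.
- by apply/colP => k; rewrite matME zA mxE.
- by apply/colP => k; rewrite matMbarE matBbarE zB.
Qed.

Lemma lp_solP P Y u : lp_sol P Y u -> exists2 z,
   std_feasible (matM D beta P) (vecd D beta P) (matMbar D d beta)
    (matBbar D d *m vecY Y) z & colfun z = u.
Proof.
move=> hu; have uE : colfun (\col_l u (enum_val l)) = u.
  by apply/funext => c; rewrite /colfun mxE enum_rankK.
by exists (\col_l u (enum_val l)) => //; apply/std_feasibleE; rewrite uE.
Qed.

End Bridge.

(** * The relaxation and its standard form *)

Section Relaxation.
Context {R : realType} {m nc nl d : nat}.
Variables (D : qcqp R m nc nl) (beta : 'I_nc -> seq R).
Hypothesis hwf : qcqp_wf D.
Local Notation vr := (@lshift nc nl).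
Local Notation col := (lp_col D d beta).
Implicit Types (P : 'M[R]_(nc, d.+2)) (Y : 'M[bool]_(nc, d.+1)) (u : col -> R).

Lemma vr_eq (i j : 'I_nc) : (vr i == vr j) = (i == j).
Proof. exact: (inj_eq (@lshift_inj nc nl)). Qed.

Lemma Wmat_bil u (e : bilI D) :
  Wmat u (vr (val e).1) (vr (val e).2) = u (ColWb d beta e).
Proof.
have [_ lte _ _ _] := hwf.
rewrite WmatE (bigD1 e) //= !vr_eq !eqxx /= [X in _ + X]big1 ?addr0 => [|k _]; last first.
  rewrite !vr_eq; case: eqP => [e1|]; case: eqP => [e2|]; rewrite ?mulr0 //.
  by have := lte _ (valP e); rewrite e1 e2 ltnn.
rewrite [X in _ + X]big1 ?addr0 => [|e' ee'].
  case: eqP => [e12|_]; last by rewrite addr0 mulr1.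
  by have := lte _ (valP e); rewrite e12 ltnn.
rewrite !vr_eq; have -> : ((val e).1 == (val e').1) && ((val e).2 == (val e').2) = false.
  apply/negP => /andP[/eqP e1 /eqP e2]; move/eqP: ee'; apply; apply: val_inj.
  by apply/esym; case: (val e) (val e') e1 e2 => [a1 a2] [b1 b2] /= -> ->.
rewrite add0r; case: eqP => [e1|]; case: eqP => [e2|]; rewrite ?mulr0 //.
have := lte _ (valP e); rewrite e1 e2 => h.
by have := ltn_trans h (lte _ (valP e')); rewrite ltnn.
Qed.

Lemma Wmat_sq u (k : sqI D) : Wmat u (vr (val k)) (vr (val k)) = u (ColWs d beta k).
Proof.
have [_ lte _ _ _] := hwf.
rewrite WmatE big1 ?add0r => [|e _]; last first.
  rewrite !vr_eq; have lt_e := lte _ (valP e).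
  case: eqP => [e1|_]; case: eqP => [e2|_]; rewrite ?andbF ?addr0 ?mulr0 //.
  by move: lt_e; rewrite -e1 -e2 ltnn.
rewrite (bigD1 k) //= eqxx mulr1 big1 ?addr0 // => k' kk'.
rewrite !vr_eq; case: eqP => [e|_]; last by rewrite mulr0.
by move/eqP: kk'; case; apply: val_inj.
Qed.

Lemma Wmat_sym u : (Wmat u)^T = Wmat u.
Proof.
apply/matrixP => i j; rewrite mxE !WmatE; congr (_ + _); apply: eq_bigr => e _.
  by rewrite [X in _ * X = _]addrC; congr (_ * (_ + _)); rewrite andbC.
by rewrite andbC.
Qed.

(** Symmetric matrices that agree on the bilinear and square positions are not
distinguished by the forms, since the quadratic data vanish elsewhere. *)
Lemma form_eqW s (x : 'cV[R]_(nc + nl)) (W W' : 'M[R]_(nc + nl)) :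
  W^T = W -> W'^T = W' ->
  (forall e, e \in bil D -> W (vr e.1) (vr e.2) = W' (vr e.1) (vr e.2)) ->
  (forall k, k \in sq D -> W (vr k) (vr k) = W' (vr k) (vr k)) ->
  Defs.form D s x W = Defs.form D s x W'.
Proof.
move=> Ws W's eb es; have [qs _ qb qd _] := hwf.
rewrite /Defs.form; congr (_ + _); apply: eq_bigr => i _; apply: eq_bigr => j _.
have upper (i' j' : 'I_(nc + nl)) : (i' < j')%N ->
    quad D s i' j' * W i' j' = quad D s i' j' * W' i' j'.
  move=> ij; have [->|q0] := eqVneq (quad D s i' j') 0; first by rewrite !mul0r.
  by have [e eB [-> ->]] := qb s _ _ ij q0; rewrite eb.
have [ij|ji|ij] := ltngtP i j; first exact: upper.
  have symE (M : 'M[R]_(nc + nl)) : M^T = M -> M i j = M j i.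
    by move=> MT; rewrite -{1}MT mxE.
  by rewrite (symE _ (qs s)) (symE _ Ws) (symE _ W's) upper.
have {ij} <- : i = j by apply: val_inj.
have [->|q0] := eqVneq (quad D s i i) 0; first by rewrite !mul0r.
by have [k kQ ->] := qd s _ q0; rewrite es.
Qed.

(** From z, the matrix W is taken to be 0 off the bilinear and square positions. *)
Lemma lp_sol_feasible P Y u : lp_sol D beta P Y u ->
  exists L2 L1, pmr_feasible D beta P (realY Y) (xvec u) (Wmat u) L2 L1.
Proof.
move=> [u0 rows link].
pose L2 e : 'M[R]_(d.+2) :=
  if insub e is Some e' then \matrix_(k, l) u (ColL2 beta (e' : bilI D) k l) else 0.
pose L1 k : 'rV[R]_(d.+2) :=
  if insub k is Some k' then \row_l u (ColL1 beta (k' : sqI D) l) else 0.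
have slack_le a b (c : col) : a + u c = b -> a <= b by move=> <-; rewrite lerDl.
exists L2, L1; split; last split.
- split.
  + move=> i; rewrite mxE u0 /=; exact: slack_le (rows (inr (IneqUb D d beta i))).
  + exact: Wmat_sym.
  + by move=> i; exact: slack_le (rows (inr (IneqF D d beta i))).
- move=> e eB; pose e' : bilI D := exist _ e eB.
  have L2E k l : L2 e k l = u (ColL2 beta e' k l).
    by rewrite /L2 insubT /= mxE.
  split.
  + by move=> k l; rewrite L2E.
  + split.
    * rewrite mxE; have /eqP := rows (inl (EqXi e')); rewrite /= subr_eq0 => /eqP ->.
      by apply: eq_bigr => k _; apply: eq_bigr => l _; rewrite L2E.
    * rewrite mxE; have /eqP := rows (inl (EqXj e')); rewrite /= subr_eq0 => /eqP ->.
      by apply: eq_bigr => k _; apply: eq_bigr => l _; rewrite L2E.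
    * rewrite (Wmat_bil u e'); have /eqP := rows (inl (EqW e')).
      rewrite /= subr_eq0 => /eqP ->.
      by apply: eq_bigr => k _; apply: eq_bigr => l _; rewrite L2E.
    * have /= <- := rows (inl (EqSum e')).
      by apply: eq_bigr => k _; apply: eq_bigr => l _; rewrite L2E.
  + move=> l; have /slack_le /= := link (LinkI e' l); apply: le_trans.
    by rewrite le_eqVlt; apply/orP; left; apply/eqP/eq_bigr => k _; rewrite L2E.
  + move=> k; have /slack_le /= := link (LinkJ e' k); apply: le_trans.
    by rewrite le_eqVlt; apply/orP; left; apply/eqP/eq_bigr => l _; rewrite L2E.
- move=> k kQ; pose k' : sqI D := exist _ k kQ.
  have L1E l : L1 k 0 l = u (ColL1 beta k' l).
    by rewrite /L1 insubT /= mxE.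
  have W_k := Wmat_sq u k'; rewrite /= in W_k.
  split.
  + by move=> l; rewrite L1E.
  + split.
    * rewrite mxE; have /eqP := rows (inl (EqXk k')); rewrite /= subr_eq0 => /eqP ->.
      by apply: eq_bigr => l _; rewrite L1E.
    * rewrite W_k; have /slack_le /= := rows (inr (IneqSq d beta k')).
      rewrite subr_le0 => /le_trans; apply.
      by rewrite le_eqVlt; apply/orP; left; apply/eqP/eq_bigr => l _; rewrite L1E.
    * have /= <- := rows (inl (EqSumk k')).
      by apply: eq_bigr => l _; rewrite L1E.
  + move=> j; rewrite W_k mxE.
    by have /slack_le /= := rows (inr (IneqTan (k := k') j)); lra.
  + by move=> l; rewrite L1E; have /slack_le := link (LinkK k' l).
Qed.

(** The standard form also asks W >= 0, which the relaxation does not. On calP this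
is automatic: bilinear entries are combinations of products of partition
points, and the tangent at the partition point 0 gives W_kk >= 0. *)
Lemma feasible_lp_sol P Y x W L2 L1 : calP P ->
  pmr_feasible D beta P (realY Y) x W L2 L1 ->
  exists2 u, lp_sol D beta P Y u &
    forall s, Defs.form D s (xvec u) (Wmat u) = Defs.form D s x W.
Proof.
move=> [P01 Pl Pr _] [[/= x01 Wsym Fi] [bilP sqP]].
(* v ignores the slacks; u adds them, each computed from the row at v. *)
pose v c : R := match c : col with
  | ColX i => x i 0
  | ColWb e => W (vr (val e).1) (vr (val e).2)
  | ColWs k => W (vr (val k)) (vr (val k))
  | ColL2 e k l => L2 (val e) k l
  | ColL1 k l => L1 (val k) 0 l
  | _ => 0
  end.
pose u c : R := match c : col with
  | ColSlack r => row_rhs P (inr r : lp_row D d beta) - ineq_lhs P v r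
  | ColLinkSlack r => link_rhs (realY Y) r - link_lhs v r
  | _ => v c
  end.
have xvecE w : (forall i, w (ColX D d beta i) = x i 0) -> xvec w = x.
  by move=> wx; apply/colP => i; rewrite mxE.
have Wv : Wmat u = Wmat v by apply/matrixP => i j; rewrite !WmatE.
have formE s : Defs.form D s (xvec u) (Wmat u) = Defs.form D s x W.
  rewrite xvecE //; apply: form_eqW => //; first exact: Wmat_sym.
    by move=> e eB; rewrite (Wmat_bil u (exist _ e eB)).
  by move=> k kQ; rewrite (Wmat_sq u (exist _ k kQ)).
have formv s : Defs.form D s (xvec v) (Wmat v) = Defs.form D s x W.
  by rewrite -formE Wv !xvecE.
exists u => //; split.
- case.
  + by move=> i /=; case/andP: (x01 i).
  + move=> e /=; have [L0 [_ _ -> _] _ _] := bilP _ (valP e).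
    apply: sumr_ge0 => k _; apply: sumr_ge0 => l _.
    have [/andP[p1 _] /andP[p2 _]] := (P01 (val e).1 l, P01 (val e).2 k).
    by rewrite !mulr_ge0.
  + move=> k /=; have [_ _ tan _] := sqP _ (valP k).
    by have := tan (inl ord0); rewrite /= Pl mulr0 mul0r expr0n /= subr0.
  + by move=> e k l /=; have [] := bilP _ (valP e).
  + by move=> k l /=; have [] := sqP _ (valP k).
  + case=> [i|i|k|k j] /=; rewrite subr_ge0.
    * by rewrite formv.
    * by case/andP: (x01 i).
    * by have [_ [_ h _] _ _] := sqP _ (valP k); rewrite subr_le0.
    * by have [_ _ /(_ j) h _] := sqP _ (valP k); lra.
  + case=> [e l|e k|k l] /=; rewrite subr_ge0.
    * by have [_ _ h _] := bilP _ (valP e).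
    * by have [_ _ _ h] := bilP _ (valP e).
    * by have [_ _ _ h] := sqP _ (valP k).
- case=> [[e|e|e|e|k|k]|r] /=.
  + by have [_ [-> _ _ _] _ _] := bilP _ (valP e); rewrite subrr.
  + by have [_ [_ -> _ _] _ _] := bilP _ (valP e); rewrite subrr.
  + by have [_ [_ _ -> _] _ _] := bilP _ (valP e); rewrite subrr.
  + by have [_ [_ _ _ ->] _ _] := bilP _ (valP e).
  + by have [_ [-> _ _] _ _] := sqP _ (valP k); rewrite subrr.
  + by have [_ [_ _ ->] _ _] := sqP _ (valP k).
  + have -> : ineq_lhs P u r = ineq_lhs P v r.
      by case: r => [i|i|k|k j] //=; rewrite formE formv.
    by rewrite addrC subrK.
- by case=> [e l|e k|k l] /=; rewrite addrC subrK.
Qed.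

End Relaxation.

(** * Bounds on solutions, and slack columns *)

Section Bounds.
Context {R : realType} {m nc nl d : nat}.
Variables (D : qcqp R m nc nl) (beta : 'I_nc -> seq R).
Hypothesis hbeta : forall k, k \in sq D -> forall a, a \in beta k -> 0 <= a <= 1.
Local Notation vr := (@lshift nc nl).
Local Notation col := (lp_col D d beta).
Implicit Types (P : 'M[R]_(nc, d.+2)) (Y : 'M[bool]_(nc, d.+1)) (u : col -> R).

Definition is_slack (c : col) : bool :=
  match c with ColSlack _ | ColLinkSlack _ => true | _ => false end.

Lemma form_slack s (c : col) : is_slack c ->
  Defs.form D s (xvec (fun c' => (c' == c)%:R)) (Wmat (fun c' => (c' == c)%:R)) = 0.
Proof.
move=> sc.
have -> : xvec (fun c' => (c' == c)%:R) = 0 :> 'cV[R]_(nc + nl).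
  by apply/colP => i; rewrite !mxE; case: eqP => // E; rewrite -E in sc.
have -> : Wmat (fun c' => (c' == c)%:R) = 0 :> 'M[R]_(nc + nl).
  rewrite /Wmat !big1 ?addr0 // => e _;
    by case: eqP => [E|_]; [rewrite -E in sc|rewrite scale0r].
rewrite /Defs.form /frob !big1 ?addr0 // => i _; rewrite big1 // => j _; by rewrite mxE mulr0.
Qed.

Lemma weighted_le1 (I : finType) (w a : I -> R) :
  (forall i, 0 <= w i) -> \sum_i w i = 1 -> (forall i, a i <= 1) ->
  \sum_i w i * a i <= 1.
Proof.
move=> w0 w1 a1; rewrite -[X in _ <= X]w1; apply: ler_sum => i _.
by rewrite ler_piMr.
Qed.

Lemma lp_sol_le1 P Y u c : calP P -> lp_sol D beta P Y u -> ~~ is_slack c -> u c <= 1.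
Proof.
move=> [P01 _ _ _] [u0 rows link].
have le1 (I : finType) (w : I -> R) i : (forall i, 0 <= w i) -> \sum_i w i = 1 -> w i <= 1.
  by move=> w0 <-; rewrite (bigD1 i) //= lerDl sumr_ge0.
have P1 i l : P i l <= 1 by case/andP: (P01 i l).
have P0 i l : 0 <= P i l by case/andP: (P01 i l).
have sum2 e : \sum_k \sum_l u (ColL2 beta e k l) = 1 := rows (inl (EqSum e)).
have sum1 k : \sum_l u (ColL1 beta k l) = 1 := rows (inl (EqSumk k)).
case: c => [i|e|k|e k l|k l|//|//] _.
- by have /= <- := rows (inr (IneqUb D d beta i)); rewrite lerDl.
- have /eqP := rows (inl (EqW e)); rewrite /= subr_eq0 => /eqP ->.
  rewrite -(sum2 e); apply: ler_sum => k _; apply: ler_sum => l _.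
  by rewrite -mulrA ler_piMr // mulr_ile1.
- have := rows (inr (IneqSq d beta k)) => /= h.
  have : u (ColWs d beta k) <= \sum_l u (ColL1 beta k l) * P (val k) l ^+ 2.
    by have := u0 (ColSlack (IneqSq d beta k)); lra.
  move/le_trans; apply; apply: weighted_le1 => // l.
  by rewrite expr_le1.
- have h k' : 0 <= \sum_l' u (ColL2 beta e k' l') by apply: sumr_ge0.
  apply: le_trans (le1 _ (fun k => \sum_l u (ColL2 beta e k l)) k h (sum2 e)).
  by rewrite (bigD1 l) //= lerDl sumr_ge0.
- exact: (le1 _ (fun l => u (ColL1 beta k l)) l _ (sum1 k)).
Qed.

(** Slacks are the difference of the right- and left-hand sides of their row, and
all other variables lie in [0, 1]. *)
Lemma lp_sol_bounded Y c :
  exists K : R, forall P u, calP P -> lp_sol D beta P Y u -> u c <= K.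
Proof.
have [sc|sc] := boolP (is_slack c); last first.
  by exists 1 => P u PP us; apply: lp_sol_le1 us sc.
case: c sc => //= [r|r] _; last first.
  exists (link_rhs (realY Y) r) => P u _ [u0 _ link].
  rewrite -link lerDr; case: r => [e l|e l|k l] //=; exact: sumr_ge0.
case: r => [i|i|k|k j].
- pose f s u := Defs.form D s (xvec u) (Wmat u).
  exists (rhs D i + \sum_(c : col) `|f (lift ord0 i) (fun c' => (c' == c)%:R)|) => P u PP us.
  have [u0 rows _] := us; have := rows (inr (IneqF D d beta i)).
  rewrite /= -/(f _ _) (linfn_expand (f (lift ord0 i))); last exact: linfn_form.
  move=> h; suff : - \sum_(c : col) `|f (lift ord0 i) (fun c' => (c' == c)%:R)| <=
     \sum_(c : col) f (lift ord0 i) (fun c' => (c' == c)%:R) * u c by lra.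
  rewrite -sumrN; apply: ler_sum => c _.
  have [sc|sc] := boolP (is_slack c).
    by rewrite /f form_slack // normr0 oppr0 mul0r.
  have := lp_sol_le1 _ _ _ _ PP us sc; have := u0 c.
  move: (f _ _) (u c) => x y y0 y1.
  have := ler_norm (- (x * y)); rewrite normrN normrM (ger0_norm y0).
  have : `|x| * y <= `|x| by rewrite ler_piMr.
  lra.
- exists 1 => P u _ [u0 rows _].
  by have /= <- := rows (inr (IneqUb D d beta i)); rewrite lerDr.
- exists 1 => P u [P01 _ _ _] [u0 rows _].
  have := rows (inr (IneqSq d beta k)) => /= h.
  have : \sum_l u (ColL1 beta k l) * P (val k) l ^+ 2 <= 1.
    apply: weighted_le1 => //; first exact: (rows (inl (EqSumk k))).
    by move=> l; case/andP: (P01 (val k) l) => p0 p1; rewrite expr_le1.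
  by have := u0 (ColWs d beta k); lra.
- exists 2 => P u PP us; have [u0 rows _] := us.
  have := rows (inr (IneqTan j)) => /= h.
  have Wle : u (ColWs d beta k) <= 1 by apply: lp_sol_le1 us _.
  have x0 := u0 (ColX D d beta (vr (val k))).
  have /andP[a0 a1] : 0 <= alpha P j <= 1.
    case: j {h} => [l|t] /=; first by case: PP.
    by apply: (hbeta _ (valP k)); apply: mem_nth.
  have a2 : alpha P j ^+ 2 <= 1 by rewrite expr_le1.
  have : 0 <= alpha P j * u (ColX D d beta (vr (val k))) by apply: mulr_ge0.
  by move: h; lra.
Qed.

Lemma matMbar_ge0 k l : 0 <= matMbar D d beta k l.
Proof.
rewrite mxE addr_ge0 ?ler0n //; case: (enum_val k) => * /=;
  rewrite ?sumr_ge0 ?ler0n // => *;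
  by rewrite ler0n.
Qed.

Lemma link_rhs_ge0 Y k : 0 <= (matBbar D d *m vecY Y) k 0 :> R.
Proof.
rewrite matBbarE; case: (enum_val k) => * /=;
  by rewrite /adjY sumr_ge0 // => t _; rewrite mxE ler0n.
Qed.

Lemma link_slack P k : exists l, [/\ costc D d beta l 0 = 0,
  forall i, matM D beta P i l = 0
  & forall k', matMbar D d beta k' l = (k' == k)%:R].
Proof.
pose c : col := ColLinkSlack beta (enum_val k).
have uE : unit_col (enum_rank c) = (fun c' => (c' == c)%:R) :> (col -> R).
  by apply/funext => c'; rewrite /unit_col enum_rankK.
exists (enum_rank c); split.
- by rewrite mxE uE form_slack.
- move=> i; rewrite mxE uE; case: (enum_val i) => [[e|e|e|e|k'|k']|[i'|i'|k'|k' j]] /=;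
  rewrite ?form_slack //;
  repeat (rewrite ?subr0 ?sub0r ?addr0 ?mulr0 ?oppr0;
    first [ by [] | apply/eqP; rewrite oppr_eq0; apply/eqP |
      (rewrite big1 // => ? _) | by rewrite !mul0r ]).
- move=> k'; rewrite mxE uE.
  have -> : link_lhs (fun c' : col => (c' == c)%:R) (enum_val k') = 0 :> R.
    by case: (enum_val k') => * /=; rewrite ?big1.
  rewrite add0r; congr (_ %:R); congr (nat_of_bool _).
  by apply/eqP/eqP => [[] /enum_val_inj|->].
Qed.

End Bounds.

(** * Derivatives along a coordinate line *)

Section Derivable.
Context {R : realType}.
Implicit Types f g : R -> R.

Definition derivable0 f := derivable f (0 : R) (1 : R).

Lemma derivable0_cst a : derivable0 (fun=> a).
Proof. exact: derivable_cst. Qed.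

Lemma derivable0D f g : derivable0 f -> derivable0 g -> derivable0 (fun t => f t + g t).
Proof. exact: derivableD. Qed.

Lemma derivable0B f g : derivable0 f -> derivable0 g -> derivable0 (fun t => f t - g t).
Proof. exact: derivableB. Qed.

Lemma derivable0M f g : derivable0 f -> derivable0 g -> derivable0 (fun t => f t * g t).
Proof. exact: derivableM. Qed.

Lemma derivable0_sum {I : finType} (F : I -> R -> R) :
  (forall i, derivable0 (F i)) -> derivable0 (fun t => \sum_i F i t).
Proof.
move=> dF; have -> : (fun t => \sum_i F i t) = \sum_(k < #|I|) F (enum_val k).
  by apply/funext => t; rewrite fct_sumE (reindex (@enum_val _ xpredT)) //;
     apply: onW_bij; exact: enum_val_bij.
by apply: derivable_sum => k; apply: dF.
Qed.

Lemma derivable0_entry {p q} (P E : 'M[R]_(p, q)) i j :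
  derivable0 (fun t => (P + t *: E) i j).
Proof.
have -> : (fun t => (P + t *: E) i j) = (fun t => P i j + t * E i j).
  by apply/funext => t; rewrite !mxE.
apply: derivable0D; first exact: derivable0_cst.
apply: derivable0M; last exact: derivable0_cst.
exact: derivable_id.
Qed.

Lemma partialP {p q} (f : 'M[R]_(p, q) -> R) (P : 'M[R]_(p, q)) i j :
  derivable0 (fun t => f (P + t *: delta_mx i j)) ->
  is_derive (0 : R) (1 : R) (fun t => f (P + t *: delta_mx i j)) (partial f P i j).
Proof. by move=> df; rewrite /partial derive1E; apply: derivableP. Qed.

Lemma has_partial_bounds {p q} (f : 'M[R]_(p, q) -> \bar R) (P : 'M[R]_(p, q)) i j
    (v g : R) :
  (forall e, 0 < e -> \forall t \near (0 : R),
     ((v + t * g - e * `|t|)%:E <= f (P + t *: delta_mx i j)%R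
       <= (v + t * g + e * `|t|)%:E)%E) ->
  has_partial f P i j g.
Proof.
move=> H.
have fin (t a b : R) : (a%:E <= f (P + t *: delta_mx i j)%R <= b%:E)%E ->
    exists2 r : R, f (P + t *: delta_mx i j) = r%:E & a <= r <= b.
  by case: (f _) => [r| |] //=; rewrite ?lee_fin ?leey ?leNye //; exists r.
split.
  by apply: filterS (H 1 ltr01) => t /fin[r ->].
apply: is_derive_bounds => e e0.
have := nbhs_singleton (H 1 ltr01).
rewrite mul0r normr0 mulr0 subr0 !addr0 => /fin[r rE vr].
have rv : r = v by apply/eqP; rewrite eq_le andbC.
rewrite rE rv; apply: filterS (H e e0) => t /fin[r' -> /andP[lo hi]].
by rewrite /= ler_norml; apply/andP; split; lra.
Qed.

End Derivable.

(** * The line through P in a coordinate direction *)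

Section Line.
Context {R : realType} {m nc nl d : nat}.
Variables (D : qcqp R m nc nl) (beta : 'I_nc -> seq R).

Lemma derivable_row (P E : 'M[R]_(nc, d.+2)) (u : lp_col D d beta -> R) r :
  derivable0 (fun t => row_lhs (P + t *: E) u r).
Proof.
have tan (k : 'I_nc) (j : tan_idx d beta k) : derivable0 (fun t => alpha (P + t *: E) j).
  case: j => [l|s] /=; [exact: derivable0_entry|exact: derivable0_cst].
have lin2 (w : 'I_d.+2 -> 'I_d.+2 -> R) (f : 'I_d.+2 -> 'I_d.+2 -> R -> R) :
    (forall k l, derivable0 (f k l)) ->
    derivable0 (fun t => \sum_k \sum_l w k l * f k l t).
  move=> df; apply: derivable0_sum => k; apply: derivable0_sum => l.
  by apply: derivable0M; [exact: derivable0_cst|exact: df].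
have lin1 (w : 'I_d.+2 -> R) (f : 'I_d.+2 -> R -> R) :
    (forall l, derivable0 (f l)) -> derivable0 (fun t => \sum_l w l * f l t).
  move=> df; apply: derivable0_sum => l.
  by apply: derivable0M; [exact: derivable0_cst|exact: df].
have sub (a : R) (f : R -> R) : derivable0 f -> derivable0 (fun t => a - f t).
  by apply: derivable0B; exact: derivable0_cst.
case: r => [[e|e|e|e|k|k]|[i|i|k|k j]] /=.
- apply: sub.
  apply: (lin2 (fun k l => u (ColL2 beta e k l)) (fun k l t => (P + t *: E) (val e).1 l)).
  by move=> k l; exact: derivable0_entry.
- apply: sub.
  apply: (lin2 (fun k l => u (ColL2 beta e k l)) (fun k l t => (P + t *: E) (val e).2 k)).
  by move=> k l; exact: derivable0_entry.
- apply: sub.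
  have -> : (fun t => \sum_k \sum_l u (ColL2 beta e k l)
        * (P + t *: E) (val e).1 l * (P + t *: E) (val e).2 k)
    = (fun t => \sum_k \sum_l u (ColL2 beta e k l)
        * ((P + t *: E) (val e).1 l * (P + t *: E) (val e).2 k)).
    apply/funext => t; apply: eq_bigr => k _; apply: eq_bigr => l _.
    by rewrite mulrA.
  apply: (lin2 (fun k l => u (ColL2 beta e k l))
    (fun k l t => (P + t *: E) (val e).1 l * (P + t *: E) (val e).2 k)).
  by move=> k l; apply: derivable0M; exact: derivable0_entry.
- exact: derivable0_cst.
- apply: sub.
  apply: (lin1 (fun l => u (ColL1 beta k l)) (fun l t => (P + t *: E) (val k) l)).
  by move=> l; exact: derivable0_entry.
- exact: derivable0_cst.
- exact: derivable0_cst.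
- exact: derivable0_cst.
- apply: derivable0D; last exact: derivable0_cst.
  apply: sub.
  apply: (lin1 (fun l => u (ColL1 beta k l)) (fun l t => (P + t *: E) (val k) l ^+ 2)).
  by move=> l; apply: derivable0M; exact: derivable0_entry.
- apply: derivable0D; last exact: derivable0_cst.
  apply: derivable0B; last exact: derivable0_cst.
  apply: derivable0M; last exact: derivable0_cst.
  by apply: derivable0M; [exact: derivable0_cst|exact: tan].
Qed.

Lemma derivable_rhs (P E : 'M[R]_(nc, d.+2)) (r : lp_row D d beta) :
  derivable0 (fun t => row_rhs (P + t *: E) r).
Proof.
have tan (k : 'I_nc) (j : tan_idx d beta k) : derivable0 (fun t => alpha (P + t *: E) j).
  case: j => [l|s] /=; [exact: derivable0_entry|exact: derivable0_cst].
case: r => [r|[i|i|k|k j]] /=; last first.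
  by apply: derivable0M; exact: tan.
all: exact: derivable0_cst.
Qed.

(** The unit matrix at (i, j) is a difference of two partitions: in row i, the
step functions jumping from 0 to 1 at j and at j + 1. So P + t E is an affine
combination of partitions, and relative interiority applies. The ends 0 and
d + 1 are excluded because a jump there would violate the fixed end points. *)
Lemma calP_line (P : 'M[R]_(nc, d.+2)) (i : 'I_nc) (j : 'I_d.+2) :
  relint (@calP R nc d) P -> (0 < j < d.+1)%N ->
  \forall t \near (0 : R), calP (P + t *: delta_mx i j).
Proof.
move=> [PP nearP] /andP[j0 jd].
have line : (fun t : R => P + t *: delta_mx i j) @ (0 : R) --> P.
  have h : (fun t : R => P + t *: delta_mx i j) @ (0 : R) --> P + (0 : R) *: delta_mx i j.
    by apply: cvgD; [exact: cvg_cst|apply: cvgZr_tmp; exact: cvg_id].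
  by rewrite scale0r addr0 in h.
have h : \forall t \near (0 : R), affine_hull (@calP R nc d) (P + t *: delta_mx i j) ->
    calP (P + t *: delta_mx i j) by exact: (line _ nearP).
apply: filterS h => t; apply.
have [P01 Pl Pr Pm] := PP.
pose step (s : nat) : 'M[R]_(nc, d.+2) :=
  \matrix_(i', l) if i' == i then (s <= l)%N%:R else P i' l.
have stepP s : (0 < s <= d.+1)%N -> calP (step s).
  move=> /andP[s0 sd]; split.
  - by move=> a l; rewrite mxE; case: eqP => // _; rewrite ler0n lern1 leq_b1.
  - by move=> a; rewrite mxE; case: eqP => // _; rewrite leqNgt s0.
  - by move=> a; rewrite mxE; case: eqP => // _; rewrite /= sd.
  - move=> a l l' ll'; rewrite !mxE; case: eqP => [_|_]; last exact: Pm.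
    rewrite ler_nat; case: (leqP s l) => // sl.
    by rewrite (leq_trans sl ll').
exists 3, (fun k : 'I_3 => nth 0 [:: 1; t; - t] k),
  (fun k : 'I_3 => nth P [:: P; step j; step j.+1] k); split.
- by rewrite !big_ord_recl big_ord0 /= addr0 subrr addr0.
- case; case=> [|[|[|//]]] lt3 //=; apply: stepP.
    by rewrite j0 ltnW.
  by rewrite ltnS.
- rewrite !big_ord_recl big_ord0 /= scale1r addr0; congr (_ + _).
  rewrite scaleNr -scalerBr; congr (_ *: _).
  apply/matrixP => a l; rewrite !mxE; case: eqP => [_|_]; last by rewrite subrr.
  rewrite /= -val_eqE /=; case: ltngtP => _; by rewrite ?subrr ?subr0.
Qed.

End Line.

(** * Value functions *)

Section Values.
Context {R : realType} {m nc nl d : nat}.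
Variables (D : qcqp R m nc nl) (beta : 'I_nc -> seq R).
Hypothesis hwf : qcqp_wf D.
Local Notation feasible P Y := (std_feasible (matM D beta P) (vecd D beta P)
  (matMbar D d beta) (matBbar D d *m vecY Y)).

Lemma value_le (P : 'M[R]_(nc, d.+2)) (Y : 'M[bool]_(nc, d.+1)) z : feasible P Y z ->
  (value D beta P Y <= (frob (costc D d beta) z)%:E)%E.
Proof.
move/std_feasibleE => /(lp_sol_feasible D beta hwf)[L2 [L1 fe]].
apply: ereal_inf_lbound; exists (xvec (colfun D beta z)), (Wmat (colfun D beta z)), L2, L1.
by rewrite costcE.
Qed.

Lemma value_ge (P : 'M[R]_(nc, d.+2)) (Y : 'M[bool]_(nc, d.+1)) (r : R) : calP P ->
  (forall z, feasible P Y z -> r <= frob (costc D d beta) z) ->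
  (r%:E <= value D beta P Y)%E.
Proof.
move=> PP lb; apply: le_ereal_inf_tmp => _ [x [W [L2 [L1 [fe ->]]]]].
have [u us ue] := feasible_lp_sol D beta hwf _ _ _ _ _ _ PP fe.
have [z zf zu] := lp_solP D beta _ _ _ us.
by rewrite lee_fin -ue -zu -costcE lb.
Qed.

End Values.

Theorem theorem1 (R : realType) (m nc nl d : nat) (D : qcqp R m nc nl)
    (beta : 'I_nc -> seq R) (P : 'M[R]_(nc, d.+2)) (Ys : 'M[bool]_(nc, d.+1))
    (zs : 'cV[R]_#|{: lp_col D d beta}|) (pis : 'cV[R]_#|{: lp_row D d beta}|)
    (hd : (1 <= d)%N)
    (hwf : qcqp_wf D)
    (hfeas : qcqp_feasible D)
    (hbeta : forall k, k \in sq D -> forall a, a \in beta k -> 0 <= a <= 1)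
    (hP : relint (@calP R nc d) P)
    (hY : unique_minimizer [set` @calY nc d] (value D beta P) Ys)
    (hz : unique_primal_solution (costc D d beta) (matM D beta P) (vecd D beta P)
            (matMbar D d beta) (matBbar D d *m vecY Ys) zs)
    (hpi : unique_dual_solution (costc D d beta) (matM D beta P) (vecd D beta P)
            (matMbar D d beta) (matBbar D d *m vecY Ys) pis) :
  forall (i : 'I_nc) (j : 'I_d.+2), (0 < j < d.+1)%N ->
    let g := \sum_(k < #|{: lp_row D d beta}|) pis k 0 *
      ((\sum_(l < #|{: lp_col D d beta}|)
           zs l 0 * partial (fun P' => matM D beta P' k l) P i j)
       - partial (fun P' => vecd D beta P' k 0) P i j) in
    has_partial (lower_value D beta) P i j g /\
    has_partial (fun P' => value D beta P' Ys) P i j g.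
Proof.
move=> i j hj g.
pose E : 'M[R]_(nc, d.+2) := delta_mx i j.
pose A t := matM D beta (P + t *: E).
pose b t := vecd D beta (P + t *: E).
pose dA : 'M[R]_(#|{: lp_row D d beta}|, #|{: lp_col D d beta}|) :=
  \matrix_(k, l) partial (fun P' => matM D beta P' k l) P i j.
pose db : 'cV[R]_#|{: lp_row D d beta}| :=
  \col_k partial (fun P' => vecd D beta P' k 0) P i j.
have A_deriv k l : is_derive (0 : R) (1 : R) (fun t => A t k l) (dA k l).
  rewrite mxE; apply: partialP.
  have -> : (fun t => matM D beta (P + t *: E) k l)
     = (fun t => row_lhs (P + t *: E) (unit_col l) (enum_val k)).
    by apply/funext => t; rewrite mxE.
  exact: derivable_row.
have b_deriv k : is_derive (0 : R) (1 : R) (fun t => b t k 0) (db k 0).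
  rewrite mxE; apply: (partialP (fun P' => vecd D beta P' k 0)).
  have -> : (fun t => vecd D beta (P + t *: E) k 0)
     = (fun t => row_rhs (P + t *: E) (enum_val k)).
    by apply/funext => t; rewrite mxE.
  exact: derivable_rhs.
have P0 : P + 0 *: E = P by rewrite scale0r addr0.
have nearP := calP_line P i j hP hj.
have bnd Y : bounded_feasible A b (matMbar D d beta) (matBbar D d *m vecY Y).
  move=> l; have [K HK] := lp_sol_bounded D beta hbeta Y (enum_val l).
  exists K; apply: filterS nearP => t Pt z /std_feasibleE /(HK _ _ Pt).
  by rewrite /colfun enum_valK.
have Ab0 := matMbar_ge0 (d := d) D beta.
have bb0 := link_rhs_ge0 D Ys.
have sl := link_slack D beta P.
rewrite -P0 in hz hpi sl.
pose v0 := frob (costc D d beta) zs.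
have gE : frob pis (dA *m zs - db) = g.
  rewrite frob_sum; apply: eq_bigr => k _; congr (_ * _).
  rewrite [LHS]mxE [(- db) k 0]mxE [db k 0]mxE; congr (_ - _).
  by rewrite mxE; apply: eq_bigr => l _; rewrite mxE mulrC.
have upper e (e0 : 0 < e) : \forall t \near (0 : R),
    (value D beta (P + t *: E)%R Ys <= (v0 + t * g + e * `|t|)%:E)%E.
  have := feasible_upper (costc D d beta) A b dA db _ _
    A_deriv b_deriv Ab0 bb0 sl zs pis hz hpi e e0.
  apply: filterS => t [z zf zc].
  by apply: le_trans (value_le D beta hwf _ _ _ zf) _; rewrite lee_fin -gE.
have lower e (e0 : 0 < e) : \forall t \near (0 : R),
    ((v0 + t * g - e * `|t|)%:E <= value D beta (P + t *: E)%R Ys)%E.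
  have := feasible_lower (costc D d beta) A b dA db _ _
    A_deriv b_deriv zs pis hz hpi e (bnd Ys) e0.
  apply: filterS2 nearP => t Pt lb; apply: value_ge => // z /lb.
  by rewrite gE.
have valueP : has_partial (fun P' => value D beta P' Ys) P i j g.
  apply: (has_partial_bounds _ _ _ _ v0) => e e0.
  by apply: filterS2 (lower e e0) (upper e e0) => t -> ->.
split=> //.
(* Near P the minimum over Y is attained at Ys, so [valueP] transfers. *)
suff lowE : \forall t \near (0 : R),
    lower_value D beta (P + t *: E) = value D beta (P + t *: E) Ys.
  apply: (has_partial_bounds _ _ _ _ v0) => e e0.
  by apply: filterS3 (lower e e0) (upper e e0) lowE => t lo hi ->; rewrite lo hi.
have [[YsY Ysmin] Ysuniq] := hY.
have v0E : value D beta P Ys = v0%:E.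
  have := nbhs_singleton (upper 1 ltr01); have := nbhs_singleton (lower 1 ltr01).
  rewrite P0 mul0r normr0 mulr0 subr0 !addr0 => lo hi.
  by apply/eqP; rewrite eq_le hi lo.
have gap (Y : 'M[bool]_(nc, d.+1)) : \forall t \near (0 : R), Y \in @calY nc d ->
    (value D beta (P + t *: E)%R Ys <= value D beta (P + t *: E)%R Y)%E.
  have [YY|nYY] := boolP (Y \in @calY nc d); last by apply: filterE.
  have [->|neY] := eqVneq Y Ys; first by apply: filterE => t _; exact: lexx.
  have lt_v : (v0%:E < value D beta P Y)%E.
    rewrite -v0E ltNge; apply/negP => le_v; move/eqP: neY; apply.
    by apply: Ysuniq; split => // Y' /Ysmin; apply: le_trans.
  (* The value at Y may be +oo, so the gap is witnessed by a real r. *)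
have [r v0r rv] : exists2 r : R, v0 < r & (r%:E < value D beta P Y)%E.
    case: (value D beta P Y) lt_v => [x| |] //.
    - by rewrite lte_fin => v0x; exists ((v0 + x) / 2); rewrite ?lte_fin; lra.
    - by move=> _; exists (v0 + 1); rewrite ?ltry //; lra.
  have Yfar : \forall t \near (0 : R), forall z,
      std_feasible (A t) (b t) (matMbar D d beta) (matBbar D d *m vecY Y) z ->
      r < frob (costc D d beta) z.
    apply: (infeasible_near (costc D d beta) A b dA db _ A_deriv b_deriv) => //.
    rewrite /A /b P0 => z zf; rewrite -lte_fin; apply: lt_le_trans rv _.
    exact: value_le zf.
  (* This radius makes v0 + t g + |t| <= r, the upper estimate with e = 1. *)
have small : \forall t \near (0 : R), `|t| < (r - v0) / (`|g| + 1).
    by apply: nbhs0_lt; rewrite divr_gt0 ?subr_gt0 // ltr_wpDl.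
  apply: filterS3 (filterI nearP Yfar) (upper 1 ltr01) small => t [Pt far] up ts _.
  have r_le : (r%:E <= value D beta (P + t *: E)%R Y)%E.
    by apply: (value_ge D beta hwf) => // z /far/ltW.
  apply: le_trans up (le_trans _ r_le).
  have g1 : 0 < `|g| + 1 by rewrite ltr_wpDl.
  rewrite lee_fin; move: ts; rewrite ltr_pdivlMr // => ts.
  have : t * g <= `|t| * `|g| by rewrite -normrM ler_norm.
  by move: ts; rewrite mulrDr; lra.
have {}gap : \forall t \near (0 : R), forall Y, Y \in @calY nc d ->
    (value D beta (P + t *: E)%R Ys <= value D beta (P + t *: E)%R Y)%E.
  exact: (@filter_forall R 'M[bool]_(nc, d.+1) (fun Y : 'M[bool]_(nc, d.+1) =>
    [set t : R | Y \in @calY nc d ->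
      (value D beta (P + t *: E)%R Ys <= value D beta (P + t *: E)%R Y)%E])
    (nbhs (0 : R)) _ gap).
apply: filterS gap => t tmin; rewrite /lower_value; apply/le_anti/andP; split.
  exact: bigmin_le_cond.
by apply/bigmin_geP; split => [|Y /tmin]; rewrite ?leey.
Qed.
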